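(* Consider constructing, to errors $\mathcal O(\gamma^p)$, the spatial discretisation of the evolution equation $u_t=\mathcal K_0u+\mathcal K(\partial_x^2)u$ on elements of equal length $H$ coupled by the edge conditions, for every $j$, $$(1-\tfrac12\gamma)(u_j^R-u_j^L)=\tfrac12\gamma(u_{j+1}^L-u_{j-1}^R)+\tfrac12\gamma\theta(u_j^L+u_j^R)-\tfrac12\gamma\theta(u_{j+1}^L+u_{j-1}^R),$$ $$(1-\tfrac12\gamma)(f_j^R-f_j^L)=\tfrac12\gamma(f_{j+1}^L-f_{j-1}^R)-\tfrac12\gamma\theta(f_j^L+f_j^R)+\tfrac12\gamma\theta(f_{j+1}^L+f_{j-1}^R),$$ with $f_j:=-u_{jx}$. The resulting holistic discretisation, that is, the power series expansion in $\gamma$ of $$\partial_tU_j=\mathcal K_0U_j+\mathcal K\left\{\frac4{H^2}\operatorname{asinh}^2\left[\sqrt{\frac{\mu_j^2-\tfrac14\theta^2\delta_j^2}{1+\tfrac12\gamma\delta_j^2-\tfrac14\gamma^2(\theta^2+1)\delta_j^2}}\,\frac{\gamma\delta_j}2\right]\right\}U_j$$ (equivalently, of $\mathcal TU_j=\frac4{H^2}\operatorname{asinh}^2[\,\cdot\,]U_j$ with the same bracket) truncated to errors $\mathcal O(\gamma^p)$ (all powers $\gamma^p$ and higher discarded), is: (i) a scheme of stencil width $(2p-1)$ on the macroscale grid; and (ii) consistent with the evolution equation $u_t=\mathcal K_0u+\mathcal K(\partial_x^2)u$ to errors $\mathcal O(\partial_x^p)$.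
   Context: A periodic interval $\mathbb X$ is partitioned into $N$ disjoint abutting open elements $\mathbb X_j=(L_j,R_j)$, $R_j=L_{j+1}$, indices modulo $N$; superscripts $R,L$ denote evaluation at the right/left edges $x=R_j,L_j$. $\gamma,\theta$ are real parameters, with full coupling being $\gamma=1$. $\mathbb U$ is a Hilbert space; $\mathbb C:=C^\omega(\mathbb X)$ and $\mathbb C_j:=C^\omega(\mathbb X_j)$ are the spaces of smooth $\mathbb U$-valued fields, with $u_j\in\mathbb C_j$. $\mathcal K_k:\mathbb U\to\mathbb U$ are linear operators with $\mathcal K_1$ invertible, and $\mathcal K:\mathbb C\to\mathbb C$ is isotropic and invertible, formally expandable as $\mathcal K=\mathcal K(\partial_x^2)=\sum_{k=1}^\infty\mathcal K_k\partial_x^{2k}$; $\mathcal K\{\mathcal R\}=\sum_{k\ge1}\mathcal K_k\mathcal R^k$. The inverse is in the sense of reverting the operator function: if $A=\mathcal K(\mathcal R)$ then $\mathcal R=\mathcal K^{-1}(A)$; and $\mathcal T:=\mathcal K^{-1}(\partial_t-\mathcal K_0)$. $U_j(t)\in\mathbb U$ is the macroscale grid value (a local average, or midpoint value, of $u_j$ in the $j$th element). $E_j^{\pm1}U_j=U_{j\pm1}$; $\delta_j=E_j^{1/2}-E_j^{-1/2}$, $\mu_j=\tfrac12(E_j^{1/2}+E_j^{-1/2})$, $\mu_j^2=1+\tfrac14\delta_j^2$; operator functions are interpreted as power series in the operators. Stencil width $(2p-1)$: the right-hand side involves only $U_{j-(p-1)},\ldots,U_{j+(p-1)}$. Consistency: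 interpolate $U_j(t)$ by a smooth field $U(t,x)$ with one step in $j$ being a step $H$ in $x$, so that $\delta_j=2\sinh(H\partial_x/2)$ and $\mu_j=\cosh(H\partial_x/2)$ as power series in $\partial_x$. ''Consistent to errors $\mathcal O(\partial_x^p)$'' means that at $\gamma=1$ the resulting equivalent PDE agrees with $\partial_tU=\mathcal K_0U+\mathcal K(\partial_x^2)U$ in all terms $\partial_x^qU$ with $q<p$. *)

(* Defs.v *)
From HB Require Import structures.
From mathcomp Require Export all_boot all_order all_algebra.
From mathcomp Require Export sesquilinear.
From mathcomp Require Export all_classical all_reals all_analysis.
Export Order.TTheory GRing.Theory Num.Theory.
Export numFieldNormedType.Exports.

Set Implicit Arguments.
Unset Strict Implicit.
Unset Printing Implicit Defensive.

Local Open Scope classical_set_scope.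
Local Open Scope ring_scope.

(** * Formal power series *)

(* [f n] is the coefficient of the n-th power of the formal variable. *)
Definition fps (A : Type) := nat -> A.

HB.instance Definition _ (A : Type) := gen_eqMixin (fps A).
HB.instance Definition _ (A : Type) := gen_choiceMixin (fps A).

Section FpsZmod.
Variable A : zmodType.
Definition fps_zero : fps A := fun=> 0.
Definition fps_opp (f : fps A) : fps A := fun n => - f n.
Definition fps_add (f g : fps A) : fps A := fun n => f n + g n.

Fact fps_addA : associative fps_add.
Proof. by move=> f g h; apply/funext => n; exact: addrA. Qed.
Fact fps_addC : commutative fps_add.
Proof. by move=> f g; apply/funext => n; exact: addrC. Qed.
Fact fps_add0 : left_id fps_zero fps_add.
Proof. by move=> f; apply/funext => n; exact: add0r. Qed.
Fact fps_addN : left_inverse fps_zero fps_opp fps_add.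
Proof. by move=> f; apply/funext => n; exact: addNr. Qed.

HB.instance Definition _ :=
  GRing.isZmodule.Build (fps A) fps_addA fps_addC fps_add0 fps_addN.
End FpsZmod.

Section FpsRing.
Variable A : comNzRingType.
Definition fps_cst (a : A) : fps A := fun n => if n is 0%N then a else 0.
Definition fps_mul (f g : fps A) : fps A :=
  fun n => \sum_(i < n.+1) f i * g (n - i)%N.

Fact fps_mulE N (f g : fps A) n : (n < N)%N ->
  fps_mul f g n = (\poly_(i < N) f i * \poly_(i < N) g i)`_n.
Proof.
move=> nN; rewrite coefM; apply: eq_bigr => i _.
have iN : (i < N)%N by rewrite (leq_ltn_trans _ nN) // -ltnS.
have niN : (n - i < N)%N by rewrite (leq_ltn_trans _ nN) // leq_subr.
by rewrite !coef_poly iN niN.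
Qed.

Fact fps_mulC : commutative fps_mul.
Proof. by move=> f g; apply/funext => n; rewrite !(fps_mulE _ _ (ltnSn n)) mulrC. Qed.

Fact fps_mulA : associative fps_mul.
Proof.
move=> f g h; apply/funext => n.
have T p q i : (i <= n)%N ->
    fps_mul p q i = (\poly_(k < n.+1) p k * \poly_(k < n.+1) q k)`_i.
  by move=> i_n; apply: fps_mulE.
transitivity
  ((\poly_(k < n.+1) f k * (\poly_(k < n.+1) g k * \poly_(k < n.+1) h k))`_n).
  rewrite coefM; apply: eq_bigr => i _.
  by rewrite T ?leq_subr// coef_poly ltn_ord.
rewrite mulrA coefM; apply: eq_bigr => i _.
by rewrite T -1?ltnS// coef_poly ltnS leq_subr.
Qed.

Fact fps_mul1 : left_id (fps_cst 1) fps_mul.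
Proof.
move=> f; apply/funext => n; rewrite /fps_mul big_ord_recl /= mul1r subn0.
by rewrite big1 ?addr0 // => i _; rewrite mul0r.
Qed.

Fact fps_mulDl : left_distributive fps_mul +%R.
Proof.
move=> f g h; apply/funext => n; rewrite /GRing.add /= /fps_add /fps_mul.
by rewrite -big_split /=; apply: eq_bigr => i _; rewrite mulrDl.
Qed.

Fact fps_oner_neq0 : fps_cst 1 != 0 :> fps A.
Proof. by apply/eqP => /(congr1 (fun f : fps A => f 0%N))/eqP; rewrite /= oner_eq0. Qed.

HB.instance Definition _ := GRing.Zmodule_isComNzRing.Build (fps A)
  fps_mulA fps_mulC fps_mul1 fps_mulDl fps_oner_neq0.
End FpsRing.

(** * The operator formula *)

Section Formula.
Variable R : realType.

(* R[[d]][[gamma]], where d stands for the derivative in x. *)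
Notation series := (fps (fps R)).

Definition coef2 (f : series) (m q : nat) : R := (f : nat -> nat -> R) m q.

Definition scal (a : R) : series := fps_cst (fps_cst a).
Definition gamma : series := fun m => if m == 1%N then fps_cst 1 else 0.

(* exp (a d): shift by a in x; [Eshift H] is the grid shift E and
   [Eshift (H / 2)] its formal square root. *)
Definition Eshift (a : R) : series :=
  fps_cst ((fun q => a ^+ q / q`!%:R) : fps R).

Definition delta (H : R) : series := Eshift (H / 2) - Eshift (- (H / 2)).
Definition mu (H : R) : series :=
  scal 2^-1 * (Eshift (H / 2) + Eshift (- (H / 2))).

(* sum_n c n z^n, meaningful only if z has no constant term: then z^n has no
   term gamma^m d^q with m + q < n. *)
Definition subst (c : nat -> R) (z : series) : series :=
  fun m q => \sum_(n < (m + q).+1) c n * coef2 (z ^+ n) m q.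

(* Maclaurin coefficients of 1 / (1 + z), sqrt (1 + z) and asinh z. *)
Definition inv1p_coef (n : nat) : R := (-1) ^+ n.
Definition sqrt1p_coef (n : nat) : R :=
  (\prod_(i < n) (2^-1 - i%:R)) / n`!%:R.
Definition asinh_coef (n : nat) : R :=
  if odd n then
    (-1) ^+ n./2 * (n.-1)`!%:R / (4 ^+ n./2 * (n./2)`!%:R ^+ 2 * n%:R)
  else 0.

(* The first two are meant for series with constant term 1. *)
Definition series_inv (f : series) : series := subst inv1p_coef (f - 1).
Definition series_sqrt (f : series) : series := subst sqrt1p_coef (f - 1).
Definition series_asinh (z : series) : series := subst asinh_coef z.

Definition bracket (H theta : R) : series :=
  let d2 := delta H ^+ 2 in
  series_sqrt
    ((mu H ^+ 2 - scal (theta ^+ 2 / 4) * d2) *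
     series_inv (1 + scal 2^-1 * gamma * d2
                   - scal ((theta ^+ 2 + 1) / 4) * gamma ^+ 2 * d2))
  * (gamma * delta H * scal 2^-1).

Definition T_formula (H theta : R) : series :=
  scal (4 / H ^+ 2) * series_asinh (bracket H theta) ^+ 2.

End Formula.

Section Scheme.
Variables (R : realType) (V : lmodType R).

(* The coefficient of gamma^m d^q in K 0 + sum_(k >= 1) K k (T_formula)^k,
   applied to u; (T_formula)^k does not contribute if m + q < k. *)
Definition formula_coef (K : nat -> V -> V) (H theta : R) (m q : nat) (u : V) : V :=
  (if (m == 0%N) && (q == 0%N) then K 0%N u else 0)
  + \sum_(1 <= k < (m + q).+1) coef2 (T_formula H theta ^+ k) m q *: K k u.

(* A stencil c stands for the operator sum_i c_i E^i, with c_i : V -> V. *)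
Definition stencil := int -> V -> V.

Definition finite_stencil (c : stencil) :=
  finite_set [set i : int | exists u, c i u != 0].

(* The coefficient of d^q in sum_i c_i exp (i H d), applied to u.  As H is
   nonzero, a finite stencil is determined by its symbol. *)
Definition symbol (H : R) (c : stencil) (q : nat) (u : V) : V :=
  \sum_(i \in [set: int]) ((i%:~R * H) ^+ q / q`!%:R) *: c i u.

(* The stencils S m are the coefficients of gamma^m in the expansion. *)
Definition expands_formula (K : nat -> V -> V) (H theta : R) (S : nat -> stencil) :=
  (forall m, finite_stencil (S m)) /\
  (forall m q u, symbol H (S m) q u = formula_coef K H theta m q u).

Definition truncation (p : nat) (g : R) (S : nat -> stencil) : stencil :=
  fun i u => \sum_(m < p) g ^+ m *: S m i u.

(* c i = 0 unless 2 |i| + 1 <= w. *)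
Definition has_stencil_width (w : nat) (c : stencil) :=
  forall i u, (w < (absz i).*2.+1)%N -> c i u = 0.

Definition pde_coef (K : nat -> V -> V) (q : nat) (u : V) : V :=
  if odd q then 0 else K q./2 u.

Definition consistent_to (K : nat -> V -> V) (H : R) (p : nat) (c : stencil) :=
  forall q u, (q < p)%N -> symbol H c q u = pde_coef K q u.

Definition cyc_shift N (k : int) (j : 'I_N) : 'I_N :=
  match k with Posz n => iter n (@ordS N) j | Negz n => iter n.+1 (@ord_pred N) j end.

Definition apply_stencil N (c : stencil) (U : 'I_N -> V) (j : 'I_N) : V :=
  \sum_(i \in [set: int]) c i (U (cyc_shift i j)).

End Scheme.

(** * The construction from the edge conditions *)

Section Construction.
Variables (R : realType) (V : lmodType R) (N : nat).

(* Multiplication by gamma of a power series in gamma. *)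
Definition times_gamma (a : nat -> V) (m : nat) : V :=
  if m is m'.+1 then a m' else 0.

(* The meaning of U_j as a functional of u_j. *)
Inductive amplitude := Midpoint | Average.

Definition amplitude_of (amp : amplitude) (H : R) (P : {poly R}) : R :=
  match amp with
  | Midpoint => P.[0]
  | Average => (* (1/H) times the integral of P over [-H/2, H/2] *)
      H^-1 * \sum_(n < size P)
               P`_n * ((H / 2) ^+ n.+1 - (- (H / 2)) ^+ n.+1) / n.+1%:R
  end.

(* In the j-th element, with xi the offset of x from the midpoint, the subgrid
   field is u_j = sum_(m, i) gamma^m (v m j i).[xi] U_i: at each order in gamma
   it is a real polynomial in xi, linear in the grid values.
   [field v n U j xi m] is the coefficient of gamma^m in its n-th derivative. *)
Definition field (v : nat -> 'M[{poly R}]_N) (n : nat) (U : 'I_N -> V)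
    (j : 'I_N) (xi : R) : nat -> V :=
  fun m => \sum_(i < N) ((v m j i)^`(n)).[xi] *: U i.

(* The evolution is dU/dt = sum_m gamma^m G m U.  As u_j depends on t only
   through U, its time derivative is obtained by replacing U with dU/dt. *)
Definition field_dt (v : nat -> 'M[{poly R}]_N)
    (G : nat -> ('I_N -> V) -> ('I_N -> V)) (U : 'I_N -> V)
    (j : 'I_N) (xi : R) : nat -> V :=
  fun m => \sum_(a < m.+1) field v 0 (G (m - a)%N U) j xi a.

Record holistic (K : nat -> V -> V) (H theta : R) (amp : amplitude)
    (v : nat -> 'M[{poly R}]_N) (G : nat -> ('I_N -> V) -> ('I_N -> V)) : Prop := {
  (* the base at gamma = 0 is the space of piecewise constant fields *)
  holistic_base : forall j i, v 0%N j i = ((i == j)%:R)%:P;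
  holistic_amplitude : forall m j i,
    amplitude_of amp H (v m j i) = ((m == 0%N) && (i == j))%:R;
  (* u_t = K_0 u + sum_(k >= 1) K_k d^(2k) u in each element; the later terms
     of the sum vanish *)
  holistic_pde : forall U j xi m, `|xi| < H / 2 ->
    field_dt v G U j xi m =
    K 0%N (field v 0 U j xi m)
    + \sum_(1 <= k < (\max_(i < N) size (v m j i)).+1) K k (field v k.*2 U j xi m);
  holistic_edge_u : forall U j m,
    let uL i := field v 0 U i (- (H / 2)) in
    let uR i := field v 0 U i (H / 2) in
    let next := ordS j in let prev := ord_pred j in
    let jump := uR j - uL j in
    (jump - 2^-1 *: times_gamma jump) m =
    (2^-1 *: times_gamma (uL next - uR prev)
     + (2^-1 * theta) *: times_gamma (uL j + uR j)
     - (2^-1 * theta) *: times_gamma (uL next + uR prev)) m;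
  holistic_edge_f : forall U j m,
    let fL i := - field v 1 U i (- (H / 2)) in
    let fR i := - field v 1 U i (H / 2) in
    let next := ordS j in let prev := ord_pred j in
    let jump := fR j - fL j in
    (jump - 2^-1 *: times_gamma jump) m =
    (2^-1 *: times_gamma (fL next - fR prev)
     - (2^-1 * theta) *: times_gamma (fL j + fR j)
     + (2^-1 * theta) *: times_gamma (fL next + fR prev)) m
}.

End Construction.

(* Main.v *)
From HB Require Import structures.
From mathcomp Require Import ring zify.
Require Import Defs.

Set Implicit Arguments.
Unset Strict Implicit.
Unset Printing Implicit Defensive.

Local Open Scope ring_scope.

(* Let E be the shift by one element.  At each order in gamma everything is a
   polynomial in delta^2 = E - 2 + E^-1 with real coefficients, so one works with
   power series in gamma over a commutative ring containing E.

   A subgrid field with u_xx = T u is u = cosh(sqrt T xi) a + sinh(sqrt T xi)/sqrt T b,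
   xi being the offset from the midpoint.  On such fields the two edge conditions
   become two linear equations for a and b; eliminating b gives
     sinh^2 (sqrt T H/2) = gamma^2 (mu^2 delta^2 - theta^2 delta^4 / 4)
                           / (4 (1 + gamma delta^2 / 2 - gamma^2 (theta^2 + 1) delta^2 / 4)),
   whose only small solution is the operator of the statement.  Since T = O(gamma),
   the field is polynomial in xi at each order, the normalisation of the amplitude
   determines a, and K 0 + sum_k K_k T^k solves the evolution equation.  As the
   coefficients are real, the K_k need not commute.

   Uniqueness goes by induction on the order: the difference d of two candidates at a
   new order satisfies sum_(k >= 1) K_k d^(2k) = const, so d'' is constant since K_1
   is injective; the jumps of d and d' vanish, so d is constant, and the amplitude
   gives d = 0.

   The coefficient of gamma^m in T has degree at most m in delta^2, hence the stencil
   width.  It also has no term d_x^q with q < m, so at orders q < p the truncation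
   agrees with the full series at gamma = 1, where the dispersion relation reads
   sinh^2 (sqrt T H/2) = delta^2 / 4, that is T = d_x^2. *)

(** * Substitution into power series *)

Section FpsCoefficients.
Variable A : comNzRingType.
Implicit Types f g : fps A.

Lemma fpsP f g : (forall n, f n = g n) -> f = g.
Proof. by move=> fg; apply/funext. Qed.

Lemma fpsDE f g n : (f + g) n = f n + g n. Proof. by []. Qed.
Lemma fpsNE f n : (- f) n = - f n. Proof. by []. Qed.
Lemma fpsBE f g n : (f - g) n = f n - g n. Proof. by []. Qed.
Lemma fps1E n : (1 : fps A) n = (n == 0%N)%:R. Proof. by case: n. Qed.
Lemma fpsME f g n : (f * g) n = \sum_(i < n.+1) f i * g (n - i)%N.
Proof. by []. Qed.

Lemma fpsM_poly N f g n : (n < N)%N ->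
  (f * g) n = (\poly_(i < N) f i * \poly_(i < N) g i)`_n.
Proof. exact: fps_mulE. Qed.

Lemma fps_sumE (I : Type) (r : seq I) (P : pred I) (F : I -> fps A) n :
  (\sum_(i <- r | P i) F i) n = \sum_(i <- r | P i) F i n.
Proof. by apply: (big_rec2 (fun (x : fps A) (y : A) => x n = y)) => // i x y _ <-. Qed.

Lemma fpsM_coef0 f g : (f * g) 0%N = f 0%N * g 0%N.
Proof. by rewrite fpsME big_ord1. Qed.

Lemma fpsX_coef0 f n : (f ^+ n) 0%N = f 0%N ^+ n.
Proof. by elim: n => [|n IH] //; rewrite !exprS fpsM_coef0 IH. Qed.

Lemma fps_cstM a f n : (fps_cst a * f) n = a * f n.
Proof.
rewrite fpsME big_ord_recl subn0 big1 ?addr0 // => i _.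
by rewrite /= mul0r.
Qed.

Fact fps_cst_zmod : zmod_morphism (@fps_cst A).
Proof. by move=> a b; apply/fpsP => -[|n] //=; rewrite fpsBE /= subr0. Qed.
Fact fps_cst_monoid : monoid_morphism (@fps_cst A).
Proof.
split=> // a b; apply/fpsP => n; rewrite fps_cstM.
by case: n => [|n] //=; rewrite mulr0.
Qed.
HB.instance Definition _ :=
  GRing.isZmodMorphism.Build A (fps A) (@fps_cst A) fps_cst_zmod.
HB.instance Definition _ :=
  GRing.isMonoidMorphism.Build A (fps A) (@fps_cst A) fps_cst_monoid.

Definition fpsX : fps A := fun n => (n == 1%N)%:R.

Lemma fpsXM f n : (fpsX * f) n = if n is n'.+1 then f n' else 0.
Proof.
rewrite fpsME; case: n => [|n]; first by rewrite big_ord1 /= mul0r.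
rewrite !big_ord_recl /= mul0r add0r mul1r subn1 big1 ?addr0 // => i _.
by rewrite mul0r.
Qed.

Lemma fpsXnM k f n :
  (fpsX ^+ k * f) n = if (k <= n)%N then f (n - k)%N else 0.
Proof.
elim: k n => [|k IH] n; first by rewrite mul1r subn0.
by rewrite exprS -mulrA fpsXM; case: n => [|n] //; rewrite IH subSS.
Qed.

Lemma fpsXn k n : (fpsX ^+ k) n = (n == k)%:R.
Proof.
rewrite -[_ ^+ k]mulr1 fpsXnM fps1E subn_eq0; case: ltngtP => //.
Qed.

Definition adic N f := forall n, (n < N)%N -> f n = 0.

Lemma adicM a b f g : adic a f -> adic b g -> adic (a + b) (f * g).
Proof.
move=> fa gb n nab; rewrite fpsME big1 // => i _.
case: (ltnP i a) => ia; first by rewrite fa ?mul0r.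
rewrite gb ?mulr0 //; have := ltn_ord i; lia.
Qed.

Lemma adic_exp f n : adic 1 f -> adic n (f ^+ n).
Proof. by move=> f1; elim: n => [|n IH] //; rewrite exprS -add1n; exact: adicM. Qed.

Lemma adic1 f : f 0%N = 0 -> adic 1 f.
Proof. by move=> f0 [|]. Qed.

End FpsCoefficients.
Arguments fpsX {A}.

(** A separated decreasing filtration, which expresses convergence in [L]. The same substitution
    lemmas then serve for the X-adic filtration and for the total degree in gamma and d; limits are
    exhibited explicitly. *)
Record filtered (L : comNzRingType) (I : nat -> L -> Prop) : Prop := {
  fil0 : forall N, I N 0;
  filD : forall N x y, I N x -> I N y -> I N (x + y);
  filM : forall a b x y, I a x -> I b y -> I (a + b)%N (x * y);
  fil_all : forall x, I 0%N x;
  filS : forall N x, I N.+1 x -> I N x;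
  fil_sep : forall x, (forall N, I N x) -> x = 0 }.

Lemma adic_filtered (A : comNzRingType) : filtered (@adic A).
Proof.
split=> //.
- by move=> N x y xN yN n nN; rewrite fpsDE xN // yN // addr0.
- exact: adicM.
- by move=> N x xN n nN; apply: xN; apply: ltnW.
- by move=> x xN; apply/fpsP => n; apply: (xN n.+1).
Qed.

(* [y] is the sum of the [c n z^n] for the topology given by [I]. *)
Definition evaluates (R L : comNzRingType) (I : nat -> L -> Prop)
    (iota : R -> L) (c : fps R) (z y : L) :=
  forall N, I N (y - \sum_(n < N) iota (c n) * z ^+ n).

(** * Calculus of convergent substitutions *)

Section Evaluates.
Variables (R L : comNzRingType) (I : nat -> L -> Prop).
Hypothesis FI : filtered I.
Variable iota : {rmorphism R -> L}.
Implicit Types (c : fps R) (x y z w : L).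

Lemma filMr N x y : I N x -> I N (x * y).
Proof. by move=> xN; rewrite -[N]addn0; apply: (filM FI) => //; apply: (fil_all FI). Qed.

Lemma filMl N x y : I N y -> I N (x * y).
Proof. by rewrite mulrC; exact: filMr. Qed.

Lemma filN N x : I N x -> I N (- x).
Proof. by rewrite -mulN1r; exact: filMl. Qed.

Lemma filB N x y : I N x -> I N y -> I N (x - y).
Proof. by move=> xN yN; apply: (filD FI) => //; apply: filN. Qed.

Lemma fil_sum N (J : Type) (r : seq J) (P : pred J) (F : J -> L) :
  (forall i, P i -> I N (F i)) -> I N (\sum_(i <- r | P i) F i).
Proof. by move=> h; elim/big_ind: _ => //; [exact: fil0 | exact: filD]. Qed.

Lemma fil_le N M x : (M <= N)%N -> I N x -> I M x.
Proof.
elim: N => [|N IH]; first by rewrite leqn0 => /eqP ->.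
by rewrite leq_eqVlt => /predU1P[->|] // MN /(filS FI); apply: IH.
Qed.

Lemma fil_exp n x : I 1%N x -> I n (x ^+ n).
Proof.
move=> x1; elim: n => [|n IH]; first exact: (fil_all FI).
by rewrite exprS -add1n; apply: (filM FI).
Qed.

Lemma fil_eq x y : (forall N, I N (x - y)) -> x = y.
Proof. by move=> h; apply/eqP; rewrite -subr_eq0; apply/eqP/(fil_sep FI). Qed.

Notation ev := (evaluates I iota).

Lemma evaluates_uniq c z y y' : ev c z y -> ev c z y' -> y = y'.
Proof.
move=> h h'; apply: fil_eq => N.
by have := filB (h N) (h' N); rewrite opprB addrA subrK.
Qed.

Lemma evaluates_coef0 c z y : I 1%N z -> ev c z y -> c 0%N = 0 -> I 1%N y.
Proof.
move=> z1 h c0; have := h 1%N.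
by rewrite big_ord1 c0 rmorph0 mul0r subr0.
Qed.

Lemma evaluatesD c c' z y y' : ev c z y -> ev c' z y' -> ev (c + c') z (y + y').
Proof.
move=> h h' N; have := filD FI (h N) (h' N).
rewrite addrACA -opprD -big_split /=.
by congr (I _ (_ - _)); apply: eq_bigr => i _; rewrite rmorphD mulrDl.
Qed.

Lemma horner_trunc c N z :
  (map_poly iota (\poly_(i < N) c i)).[z] = \sum_(n < N) iota (c n) * z ^+ n.
Proof.
have s : (size (map_poly iota (\poly_(i < N) c i)) <= N)%N.
  by rewrite (leq_trans (size_poly _ _)) ?size_poly.
rewrite (horner_coef_wide _ s); apply: eq_bigr => i _.
by rewrite coef_map coef_poly ltn_ord.
Qed.

(** Modulo [I N] both factors may be replaced by their truncations. Below degree N the product of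
    the truncations has the coefficients of [c * c']; from degree N on, the powers of [z] lie in
    [I N]. *)
Lemma evaluatesM c c' z y y' : I 1%N z ->
  ev c z y -> ev c' z y' -> ev (c * c') z (y * y').
Proof.
move=> z1 h h' N.
set p := \sum_(n < N) iota (c n) * z ^+ n.
set p' := \sum_(n < N) iota (c' n) * z ^+ n.
have -> : y * y' - \sum_(n < N) iota ((c * c') n) * z ^+ n =
  ((y - p) * y' + p * (y' - p'))
   + (p * p' - \sum_(n < N) iota ((c * c') n) * z ^+ n) by ring.
apply: (filD FI); first by apply: (filD FI); [apply: filMr; apply: h|apply: filMl; apply: h'].
rewrite /p /p' -!horner_trunc -hornerM -rmorphM -hornerN -hornerD -rmorphB /=.
set q := _ - _; rewrite horner_coef; apply: fil_sum => i _.
rewrite coef_map /=; case: (ltnP i N) => iN.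
  by rewrite /q coefB coef_poly iN -fpsM_poly // subrr rmorph0 mul0r; apply: fil0.
by apply: filMl; apply: (fil_le iN); apply: fil_exp.
Qed.

Lemma evaluates_cst a z : ev (fps_cst a) z (iota a).
Proof.
case=> [|N]; first exact: (fil_all FI).
rewrite big_ord_recl mulr1 big1 ?addr0 ?subrr; first exact: fil0.
by move=> i _; rewrite /= rmorph0 mul0r.
Qed.

Lemma evaluates1 z : ev 1 z 1.
Proof. by have := evaluates_cst 1 z; rewrite rmorph1. Qed.

Lemma evaluates0 z : ev 0 z 0.
Proof. by have := evaluates_cst 0 z; rewrite !rmorph0. Qed.

Lemma evaluatesX z : I 1%N z -> ev fpsX z z.
Proof.
move=> z1 [|[|N]]; first exact: (fil_all FI).
  by rewrite big_ord1 /fpsX rmorph_nat mul0r subr0.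
rewrite !big_ord_recl /fpsX !rmorph_nat mul0r mul1r add0r.
rewrite big1 ?addr0 ?subrr; first exact: (fil0 FI).
by move=> i _; rewrite /= rmorph0 mul0r.
Qed.

Lemma evaluatesN c z y : I 1%N z -> ev c z y -> ev (- c) z (- y).
Proof.
move=> z1 h; rewrite -mulN1r -[- y]mulN1r; apply: evaluatesM => //.
by have := evaluates_cst (-1) z; rewrite !rmorphN !rmorph1.
Qed.

Lemma evaluatesB c c' z y y' : I 1%N z ->
  ev c z y -> ev c' z y' -> ev (c - c') z (y - y').
Proof. by move=> z1 h h'; apply: evaluatesD => //; apply: evaluatesN. Qed.

Lemma evaluates_exp c z y n : I 1%N z -> ev c z y -> ev (c ^+ n) z (y ^+ n).
Proof.
move=> z1 h; elim: n => [|n IH]; first exact: evaluates1.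
by rewrite !exprS; apply: evaluatesM.
Qed.

Lemma evaluates_adic N c z y : adic N c -> ev c z y -> I N y.
Proof.
move=> cN /(_ N); rewrite big1 ?subr0 // => i _.
by rewrite cN // rmorph0 mul0r.
Qed.

(** The series b - sum_(n < N) c_n a^n has order at least N, so its value at [z], which is y -
    sum_(n < N) c_n x^n, lies in [I N]. Univariate identities c(a) = b can thus be used in any
    filtered ring. *)
Lemma evaluates_comp (c a b : fps R) z x y : I 1%N z ->
  evaluates (@adic R) (@fps_cst R) c a b -> ev a z x -> ev b z y ->
  evaluates I iota c x y.
Proof.
move=> z1 cab az bz N; apply: evaluates_adic (cab N) _.
apply: (evaluatesB z1 bz).
elim: N => [|N IH]; first by rewrite !big_ord0; exact: evaluates0.
rewrite !big_ord_recr /=; apply: evaluatesD => //.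
by apply: evaluatesM => //; [exact: evaluates_cst | exact: evaluates_exp].
Qed.

(** Induction on the order of y - y'. For k >= 2, y^k - y'^k is y - y' times a sum of products with
    a factor in [I 1], so it gains one order, while the linear term has coefficient 1. *)
Lemma evaluates_inj c y y' w : c 1%N = 1 -> I 1%N y -> I 1%N y' ->
  ev c y w -> ev c y' w -> y = y'.
Proof.
move=> c1 y1 y1' h h'; apply: fil_eq; elim=> [|N IH]; first exact: (fil_all FI).
case: N IH => [|N] IH; first exact: filB.
have := filB (h' N.+2) (h N.+2).
rewrite opprB addrC addrA subrK -sumrB !big_ord_recl /= !expr0 subrr add0r.
rewrite /bump /= c1 rmorph1 !mul1r !expr1 => H.
have K : I N.+2 (\sum_(i < N) (iota (c i.+2) * y ^+ i.+2 - iota (c i.+2) * y' ^+ i.+2)).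
  apply: fil_sum => i _; rewrite -mulrBr; apply: filMl.
  rewrite subrXX -addn1; apply: (filM FI) => //.
  apply: fil_sum => j _.
  (* The cofactor is homogeneous of degree i + 1 > 0, so in each product one of the two exponents is
     positive. *)
  case: (ltnP 0 (i.+2 - j.+1)) => ij.
    by apply: filMr; apply: (fil_le ij); apply: fil_exp.
  apply: filMl; have j0 : (0 < j)%N by case: j ij => j /=; lia.
  by apply: (fil_le j0); apply: fil_exp.
by have := filB H K; rewrite addrK.
Qed.

End Evaluates.

Section EvaluatesFps.
Variables (R A : comNzRingType) (iota : {rmorphism R -> A}).

(** Stopping at n = m loses nothing when [z] has no constant term, since then z^n starts in degree
    n. *)
Definition fps_comp (c : fps R) (z : fps A) : fps A :=
  fun m => \sum_(n < m.+1) iota (c n) * (z ^+ n) m.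

Lemma fps_compP c z : adic 1 z ->
  evaluates (@adic A) (@fps_cst A \o iota) c z (fps_comp c z).
Proof.
move=> z1 N m mN; rewrite fpsBE fps_sumE; apply/eqP; rewrite subr_eq0; apply/eqP.
under [RHS]eq_bigr do rewrite fps_cstM.
rewrite /fps_comp -!(big_mkord xpredT (fun n => iota (c n) * (z ^+ n) m)).
rewrite [RHS](@big_cat_nat _ _ _ m.+1 0 N) //=.
rewrite [X in _ = _ + X]big_nat_cond [X in _ = _ + X]big1 ?addr0 //.
by move=> i /andP[/andP[mi _] _]; rewrite (adic_exp z1) ?mulr0.
Qed.

End EvaluatesFps.

Lemma evaluates_morph (R L L' : comNzRingType) (I : nat -> L -> Prop)
    (I' : nat -> L' -> Prop) (iota : R -> L) (iota' : R -> L')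
    (phi : {rmorphism L -> L'}) c z y :
  (forall N x, I N x -> I' N (phi x)) -> (forall a, phi (iota a) = iota' a) ->
  evaluates I iota c z y -> evaluates I' iota' c (phi z) (phi y).
Proof.
move=> II' ii' h N; have := II' _ _ (h N).
rewrite rmorphB rmorph_sum /=; congr (I' _ (_ - _)).
by apply: eq_bigr => i _; rewrite rmorphM rmorphXn /= ii'.
Qed.

(** * The power series of asinh *)

Section Derivation.
Variable R : realType.
Implicit Types f g p q : fps R.

Definition fps_deriv f : fps R := fun n => n.+1%:R * f n.+1.
Notation D := fps_deriv.

Lemma fps_derivE f n : D f n = n.+1%:R * f n.+1. Proof. by []. Qed.

Fact fps_deriv_zmod : zmod_morphism fps_deriv.
Proof. by move=> f g; apply/fpsP => n; rewrite !(fps_derivE, fpsBE) mulrBr. Qed.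
HB.instance Definition _ :=
  GRing.isZmodMorphism.Build (fps R) (fps R) fps_deriv fps_deriv_zmod.

Lemma fps_derivM f g : D (f * g) = D f * g + f * D g.
Proof.
apply/fpsP => n; pose T h : {poly R} := \poly_(i < n.+2) h i.
have TD h i : (i <= n)%N -> (T h)^`()`_i = D h i.
  by move=> i_n; rewrite coef_deriv coef_poly ltnS ltnS i_n fps_derivE mulr_natl.
rewrite fps_derivE (fpsM_poly f g (ltnSn n.+1)) mulr_natl -coef_deriv derivM coefD.
rewrite fpsDE !coefM; congr (_ + _); apply: eq_bigr => i _.
  by rewrite TD -1?ltnS // coef_poly ltnS (leq_trans (leq_subr _ _)).
by rewrite TD ?leq_subr // coef_poly ltnS (leq_trans (ltnW (ltn_ord i))).
Qed.

Lemma fps_deriv_cst a : D (fps_cst a) = 0.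
Proof. by apply/fpsP => n; rewrite fps_derivE mulr0. Qed.

Lemma fps_deriv1 : D 1 = 0. Proof. exact: fps_deriv_cst. Qed.

Lemma fps_derivX : D fpsX = 1.
Proof. by apply/fpsP => -[|n]; rewrite fps_derivE /fpsX fps1E /= ?mulr1 ?mulr0. Qed.

Lemma fps_deriv_exp f n : D (f ^+ n) = n%:R * f ^+ n.-1 * D f.
Proof.
elim: n => [|[|n] IH]; first by rewrite fps_deriv1 !mul0r.
  by rewrite !mul1r.
by rewrite exprS fps_derivM IH /= exprS -(natr1 n.+1); ring.
Qed.

Lemma fps_deriv_eq f g : D f = D g -> f 0%N = g 0%N -> f = g.
Proof.
move=> Dfg fg0; apply/fpsP => -[|n] //.
have /(congr1 (fun h : fps R => h n)) : D f = D g by [].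
by apply/mulfI; rewrite pnatr_eq0.
Qed.

Lemma adic_deriv N f : adic N.+1 f -> adic N (D f).
Proof. by move=> fN n nN; rewrite fps_derivE fN ?mulr0. Qed.

Lemma adic_antideriv N f : f 0%N = 0 -> adic N (D f) -> adic N.+1 f.
Proof.
move=> f0 DfN [|n] // /DfN /eqP; rewrite mulf_eq0 pnatr_eq0 /=.
by move/eqP.
Qed.

Notation ev := (evaluates (@adic R) (@fps_cst R)).
Let F := adic_filtered R.

(** Differentiation costs one order, hence the partial sum with N + 1 terms; its derivative is the
    N-term partial sum of [D c] at [y], times [D y]. *)
Lemma fps_chain_rule c y w x : adic 1 y ->
  ev c y w -> ev (D c) y x -> D w = x * D y.
Proof.
move=> y1 cw cx; apply: (fil_eq F) => N.
have := filD F (adic_deriv (cw N.+1)) (filMr F (- D y) (cx N)).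
rewrite raddfB raddf_sum /= mulrN mulrBl opprB addrC addrA.
set S1 := \sum_(i < N.+1) _; set S2 := \sum_(i < N) _ * _.
have -> : S1 = S2 * D y.
  rewrite /S1 big_ord_recl expr0 mulr1 fps_deriv_cst add0r mulr_suml.
  apply: eq_bigr => i _; rewrite fps_derivM fps_deriv_cst mul0r add0r.
  rewrite fps_deriv_exp /= fps_derivE rmorphM /= rmorph_nat /bump /= add1n add0n; ring.
by congr (adic _ _); ring.
Qed.

(** Each integration of the system raises the order of vanishing of both unknowns by one. *)
Lemma fps_ode_uniq u p q : p 0%N = 0 -> q 0%N = 0 ->
  D p = u * q -> D q = u * p -> p = 0 /\ q = 0.
Proof.
move=> p0 q0 Dp Dq.
have H N : adic N p /\ adic N q.
  elim: N => [|N [IHp IHq]] //; split; apply: adic_antideriv => //.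
    by rewrite Dp; apply: (filMl F).
  by rewrite Dq; apply: (filMl F).
by split; apply: (fil_sep F) => N; have [] := H N.
Qed.

End Derivation.

(** * The series of 1 / (1 + x), sqrt (1 + x), cosh, sinh and asinh *)

Section Univariate.
Variable R : realType.
Notation D := (@fps_deriv R).
Notation ev := (evaluates (@adic R) (@fps_cst R)).
Notation X := (fpsX : fps R).
Let F := adic_filtered R.

Lemma inv1pM : (inv1p_coef R : fps R) * (1 + X) = 1.
Proof.
apply/fpsP => -[|n]; rewrite mulrDr mulr1 mulrC fpsDE fpsXM fps1E /inv1p_coef.
  by rewrite addr0.
by rewrite exprS /=; ring.
Qed.

(** The recurrence of the coefficients says (1 + X) f' = f / 2, so g = f^2 satisfies (1 + X) g' = g.
    With g(0) = 1, the recurrence for g produces 1, 1, 0, 0, and so on. *)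
Lemma sqrt1pM : (sqrt1p_coef R : fps R) ^+ 2 = 1 + X.
Proof.
set f : fps R := sqrt1p_coef R.
have fS n : n.+1%:R * f n.+1 = (2^-1 - n%:R) * f n.
  rewrite /f /sqrt1p_coef big_ord_recr factS natrM /=.
  by field; rewrite nat1r !pnatr_eq0 -lt0n fact_gt0.
have Df : (1 + X) * D f = fps_cst 2^-1 * f.
  apply/fpsP => n; rewrite mulrDl mul1r fpsDE fpsXM fps_cstM fps_derivE fS.
  by case: n => [|n]; rewrite ?fps_derivE; ring.
have Dg : (1 + X) * D (f ^+ 2) = f ^+ 2.
  rewrite fps_deriv_exp /= expr1 mulrCA Df.
  have -> : f ^+ 2 = fps_cst (2 * 2^-1) * f ^+ 2 by rewrite mulfV ?pnatr_eq0 // rmorph1 mul1r.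
  by rewrite rmorphM rmorph_nat; ring.
have gS n : n.+1%:R * (f ^+ 2) n.+1 = (1 - n%:R) * (f ^+ 2) n.
  have /(congr1 (fun h : fps R => h n)) := Dg.
  rewrite mulrDl mul1r fpsDE fpsXM fps_derivE.
  case: n => [|n]; rewrite ?fps_derivE; move: (f ^+ 2) => g H.
    by rewrite -H; ring.
  by rewrite mulrBl mul1r -{1}H addrK.
have g0 : (f ^+ 2) 0%N = 1.
  by rewrite fpsX_coef0 /f /sqrt1p_coef big_ord0 fact0 divr1 expr1n.
have g1 : (f ^+ 2) 1%N = 1 by have := gS 0%N; rewrite g0 subr0 !mul1r.
apply/fpsP => -[|[|n]]; rewrite ?g0 ?g1 fpsDE fps1E /fpsX /= ?addr0 ?add0r //.
elim: n => [|n IH].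
  have := gS 1%N; rewrite subrr mul0r => /eqP.
  by rewrite mulf_eq0 pnatr_eq0 /= => /eqP.
have := gS n.+2; rewrite IH mulr0 => /eqP.
by rewrite mulf_eq0 pnatr_eq0 /= => /eqP.
Qed.

(* [ch] and [sh] are [cosh (sqrt x)] and [sinh (sqrt x) / sqrt x]. *)
Definition ch : fps R := fun n => ((n.*2)`!%:R)^-1.
Definition sh : fps R := fun n => ((n.*2.+1)`!%:R)^-1.

Let fact_neq0 n : n`!%:R != 0 :> R.
Proof. by rewrite pnatr_eq0 -lt0n fact_gt0. Qed.

Lemma ch_deriv : D ch = fps_cst 2^-1 * sh.
Proof.
apply/fpsP => n; rewrite fps_cstM fps_derivE /ch /sh doubleS factS natrM.
have := fact_neq0 n.*2.+1; move: (_`!%:R) => x x0.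
have -> : n.*2.+2%:R = 2 * n.+1%:R :> R by rewrite -natrM mul2n doubleS.
by field; rewrite x0 nat1r pnatr_eq0.
Qed.

(** The derivative of sinh (sqrt x) is cosh (sqrt x) / (2 sqrt x); multiplication by 2 sqrt x
    removes all roots. *)
Lemma sh_deriv : sh + fps_cst 2 * X * D sh = ch.
Proof.
apply/fpsP => n; rewrite fpsDE -mulrA fps_cstM fpsXM /ch.
case: n => [|n]; rewrite ?fps_derivE /sh; first by rewrite mulr0 addr0.
have := fact_neq0 n.+1.*2; rewrite factS natrM; move: (_`!%:R) => x x0.
have -> : n.+1.*2.+1%:R = 2 * n.+1%:R + 1 :> R.
  by rewrite -natr1 -[n.+1.*2]mul2n natrM.
have /eqP : 2 * n.+1%:R + 1 != 0 :> R by rewrite -natrM natr1 pnatr_eq0.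
move: (n.+1%:R) => y /eqP y0.
by field; rewrite x0 y0.
Qed.

(** This is sinh (sqrt x) ^ 2. *)
Definition sinh2 : fps R := X * sh ^+ 2.

Lemma ch_sqr : ch ^+ 2 = 1 + sinh2.
Proof.
apply: fps_deriv_eq; last first.
  by rewrite fpsX_coef0 fpsDE /sinh2 fpsXM /ch fact0 invr1 expr1n addr0.
rewrite raddfD /= fps_deriv1 add0r /sinh2 fps_derivM fps_derivX !fps_deriv_exp /=.
rewrite !expr1 ch_deriv -sh_deriv.
have : fps_cst 2 * fps_cst 2^-1 = 1 :> fps R.
  by rewrite -rmorphM mulfV ?pnatr_eq0 // rmorph1.
have -> : 2%:R = fps_cst 2 :> fps R by rewrite rmorph_nat.
move: (fps_cst 2) (fps_cst 2^-1) (D sh) => u v s' E.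
transitivity ((u * v) * ((sh + u * X * s') * sh)); first by ring.
by rewrite E; ring.
Qed.

Lemma sinh2_coef1 : sinh2 1%N = 1.
Proof. by rewrite /sinh2 fpsXM fpsX_coef0 /sh invr1 expr1n. Qed.

(** Coefficient form of (1 + x^2) a'' + x a' = 0, the equation of a = asinh. *)
Lemma asinh_rec n :
  n.+2%:R * n.+1%:R * asinh_coef R n.+2 = - n%:R ^+ 2 * asinh_coef R n.
Proof.
rewrite /asinh_coef /= negbK; case: ifP => odd_n; last by rewrite !mulr0.
have [k ->] : exists k, n = k.*2.+1.
  by exists n./2; have := odd_double_half n; rewrite odd_n.
rewrite /= uphalf_double.
have -> : (k.*2.+2)`!%:R = (2 * k.+1%:R) * (2 * k%:R + 1) * (k.*2)`!%:R :> R.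
  by rewrite factS natrM factS natrM -[k.*2.+2]doubleS -!mul2n -natr1 !natrM; ring.
rewrite factS natrM.
have := fact_neq0 k; have := fact_neq0 k.*2.
move: (k`!%:R) (k.*2`!%:R) => x y y0 x0.
have h4 : 4 ^+ k != 0 :> R by rewrite expf_neq0.
have -> : k.*2.+3%:R = 2 * k%:R + 3 :> R by rewrite -addn3 natrD -mul2n natrM.
have -> : k.*2.+2%:R = 2 * k.+1%:R :> R by rewrite -natrM mul2n doubleS.
have -> : k.*2.+1%:R = 2 * k%:R + 1 :> R by rewrite -natr1 -mul2n natrM.
have k1 : k.+1%:R != 0 :> R by rewrite pnatr_eq0.
have k2 : 2 * k%:R + 1 != 0 :> R by rewrite -natrM natr1 pnatr_eq0.
have k3 : 2 * k%:R + 3 != 0 :> R by rewrite -natrM -natrD pnatr_eq0 addn3.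
move: k1 k2 k3; rewrite -(natr1 k); move: (k%:R) => z z1 z2 z3.
rewrite !exprS; move: h4; move: (4 ^+ k) ((-1) ^+ k) => f s f0.
by field; rewrite f0 x0 z1 z2 z3.
Qed.

Lemma asinh_coef1 : asinh_coef R 1 = 1.
Proof. by rewrite /asinh_coef /= fact0 !(expr0, mul1r, mulr1, expr1n, invr1). Qed.

(** The series b = (1 + X^2) a' stands for sqrt (1 + x^2): the claims are a' = 1 / b and b' = x a'.
    By the equation of asinh, a' b has derivative 0. *)
Lemma asinh_deriv_sqr (a := asinh_coef R : fps R) :
  D a * ((1 + X ^+ 2) * D a) = 1 /\ D ((1 + X ^+ 2) * D a) = X * D a.
Proof.
have ode : (1 + X ^+ 2) * D (D a) = - (X * D a).
  apply/fpsP => n; rewrite mulrDl mul1r fpsDE fpsXnM fpsNE fpsXM fps_derivE.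
  rewrite mulrCA mulrA asinh_rec.
  case: n => [|[|n]] /=; rewrite ?subSS ?subn0 ?fps_derivE -/a; ring.
have Db : D ((1 + X ^+ 2) * D a) = X * D a.
  rewrite fps_derivM ode raddfD /= fps_deriv1 fps_deriv_exp fps_derivX /=.
  by ring.
split => //; apply: fps_deriv_eq.
  rewrite fps_derivM Db fps_deriv1.
  have -> : D (D a) * ((1 + X ^+ 2) * D a) = (1 + X ^+ 2) * D (D a) * D a by ring.
  by rewrite ode; ring.
rewrite !fpsM_coef0 fpsDE fpsX_coef0 fps1E !fps_derivE /= /fpsX.
by rewrite /a asinh_coef1 expr0n !(mul1r, addr0).
Qed.

Let comp c (z : fps R) (z1 : adic 1 z) : ev c z (fps_comp idfun c z) :=
  @fps_compP R R idfun c z z1.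

(** Below, [C] is cosh a and [a * S] is sinh a. The pairs (a S, C) and (X, b), with b as in
    [asinh_deriv_sqr], solve the same linear system with equal initial values, so a S = X; squaring
    gives the claim. *)
Lemma asinhK (a := asinh_coef R : fps R) : ev sinh2 (a ^+ 2) (X ^+ 2).
Proof.
have a0 : a 0%N = 0 by [].
have A1 : adic 1 (a ^+ 2) by apply: adic1; rewrite fpsX_coef0 a0 expr0n.
have [ab Db] := asinh_deriv_sqr; rewrite -/a in ab Db.
set b := (1 + X ^+ 2) * D a in ab Db.
have [C evC C0] : exists2 C, ev ch (a ^+ 2) C & C 0%N = 1.
  exists (fps_comp idfun ch (a ^+ 2)); first exact: comp.
  by rewrite /fps_comp big_ord1 /= /ch fact0 invr1 mul1r.
have [S evS] : exists S, ev sh (a ^+ 2) S.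
  by exists (fps_comp idfun sh (a ^+ 2)); exact: comp.
have [S' evDS] : exists S', ev (D sh) (a ^+ 2) S'.
  by exists (fps_comp idfun (D sh) (a ^+ 2)); exact: comp.
have E2 : fps_cst 2 * fps_cst 2^-1 = 1 :> fps R.
  by rewrite -rmorphM mulfV ?pnatr_eq0 // rmorph1.
have DA : D (a ^+ 2) = fps_cst 2 * a * D a.
  by rewrite fps_deriv_exp /= expr1 rmorph_nat.
have evX : ev X (a ^+ 2) (a ^+ 2) := evaluatesX F _ A1.
have evc c : ev (fps_cst c) (a ^+ 2) (fps_cst c) := evaluates_cst F _ c _.
have DC : D C = (a * S) * D a.
  rewrite (fps_chain_rule A1 evC (x := fps_cst 2^-1 * S)).
    by rewrite DA; move: E2; move: (fps_cst 2^-1) (fps_cst 2) => u v E2; ring: E2.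
  by rewrite ch_deriv; exact: (evaluatesM F A1 (evc _) evS).
have CS : C = S + fps_cst 2 * a ^+ 2 * S'.
  have evC' := evaluatesD F evS (evaluatesM F A1 (evaluatesM F A1 (evc 2) evX) evDS).
  by rewrite sh_deriv in evC'; exact: (evaluates_uniq F evC evC').
have DS : D (a * S) = C * D a.
  rewrite fps_derivM (fps_chain_rule A1 evS evDS) DA CS; ring.
(* The differences p = a S - X and q = C - b satisfy p' = a' q, by a' b = 1, and q' = a' p. *)
have [] := @fps_ode_uniq R (D a) (a * S - X) (C - b).
- by rewrite fpsBE fpsM_coef0 a0 mul0r subr0.
- rewrite fpsBE C0 /b fpsM_coef0 fpsDE fpsX_coef0 fps1E !fps_derivE /= /fpsX.
  by rewrite /a asinh_coef1 expr0n !(mul1r, addr0) subrr.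
- by rewrite raddfB /= DS fps_derivX mulrBr ab; ring.
- by rewrite raddfB /= DC Db; ring.
move=> /eqP; rewrite subr_eq0 => /eqP aS _.
by rewrite -aS exprMn; exact: (evaluatesM F A1 evX (evaluates_exp F 2 A1 evS)).
Qed.

(* [asinh2] is [asinh (sqrt x) ^ 2]. *)
Definition asinh2 : fps R := fun n => ((asinh_coef R : fps R) ^+ 2) n.*2.

Lemma asinh2P (a := asinh_coef R : fps R) : ev asinh2 (X ^+ 2) (a ^+ 2).
Proof.
move=> N n nN; rewrite fpsBE fps_sumE.
under eq_bigr do rewrite fps_cstM -exprM fpsXn mul2n.
case: (boolP (odd n)) => on.
  rewrite big1 ?subr0 => [|i _]; last first.
    by case: eqP => [ni|_]; rewrite ?mulr0 //; move: on; rewrite ni odd_double.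
  rewrite expr2 fpsME big1 // => i _; rewrite /a /asinh_coef.
  have i_n : (i <= n)%N by rewrite -ltnS.
  rewrite oddB // on; case: ifP => oi; rewrite ?mul0r //= ?mulr0 //.
have n2 : (n./2 < N)%N by apply: leq_ltn_trans nN; lia.
rewrite (bigD1 (Ordinal n2)) //= even_halfK // eqxx mulr1 big1.
  by rewrite addr0 /asinh2 even_halfK // subrr.
move=> i; rewrite -val_eqE /= => ni.
case: eqP => [E|]; rewrite ?mulr0 //.
by move: ni; rewrite E doubleK eqxx.
Qed.

(** At X^2 the composite is known from [asinhK]. Substituting X^2 only moves coefficients to even
    degrees, hence is injective. *)
Lemma asinh2K : ev sinh2 asinh2 X.
Proof.
have A1 : adic 1 asinh2 by apply: adic1; rewrite /asinh2 fpsX_coef0 expr0n.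
have X1 : adic 1 (X ^+ 2) by apply: adic1; rewrite fpsXn.
have evY := comp sinh2 A1; set Y := fps_comp _ _ _ in evY.
have YX : fps_comp idfun Y (X ^+ 2) = X ^+ 2.
  apply: (evaluates_uniq F) asinhK.
  exact: (evaluates_comp F X1 evY asinh2P (comp Y X1)).
suff <- : Y = X by [].
apply/fpsP => n; have /(congr1 (fun f : fps R => f n.*2)) := YX.
rewrite /fps_comp fpsXn.
under eq_bigr do rewrite -exprM fpsXn mul2n.
have n2 : (n < n.*2.+1)%N by lia.
rewrite (bigD1 (Ordinal n2)) //= eqxx mulr1 big1 ?addr0 => [->|i].
  by congr (_%:R); rewrite -[2%N]/(1.*2) (inj_eq double_inj).
rewrite -val_eqE /= => ni.
by case: eqP => [/double_inj E|]; rewrite ?mulr0 //; case/eqP: ni.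
Qed.

Lemma asinh2_coef0 : asinh2 0%N = 0.
Proof. by rewrite /asinh2 fpsX_coef0 expr0n. Qed.

End Univariate.

(** * The dispersion relation *)

Section FpsMap.
Variables (A B : comNzRingType) (f : {rmorphism A -> B}).

Definition fps_map (x : fps A) : fps B := fun n => f (x n).

Fact fps_map_zmod : zmod_morphism fps_map.
Proof. by move=> x y; apply/fpsP => n; rewrite /fps_map !fpsBE rmorphB. Qed.
Fact fps_map_monoid : monoid_morphism fps_map.
Proof.
split=> [|x y]; apply/fpsP => n; rewrite /fps_map.
  by rewrite !fps1E rmorph_nat.
by rewrite !fpsME rmorph_sum; apply: eq_bigr => i _; rewrite rmorphM.
Qed.
HB.instance Definition _ :=
  GRing.isZmodMorphism.Build (fps A) (fps B) fps_map fps_map_zmod.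
HB.instance Definition _ :=
  GRing.isMonoidMorphism.Build (fps A) (fps B) fps_map fps_map_monoid.

Lemma fps_map_cst a : fps_map (fps_cst a) = fps_cst (f a).
Proof. by apply/fpsP => -[|n] //; rewrite /fps_map /= rmorph0. Qed.

Lemma fps_mapX : fps_map fpsX = fpsX.
Proof. by apply/fpsP => n; rewrite /fps_map /fpsX rmorph_nat. Qed.

Lemma adic_map N x : adic N x -> adic N (fps_map x).
Proof. by move=> xN n nN; rewrite /fps_map xN // rmorph0. Qed.

End FpsMap.

Section Swap.
Variable R : comNzRingType.

(* For series in [d] with coefficients polynomial in [gamma], where one can set
   [gamma = 1]. *)
Definition swap (x : fps {poly R}) : fps (fps R) := fun m q => (x q)`_m.

Fact swap_zmod : zmod_morphism swap.
Proof. by move=> x y; apply/fpsP => m; apply/fpsP => q; rewrite /swap !fpsBE coefB. Qed.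
Fact swap_monoid : monoid_morphism swap.
Proof.
split=> [|x y]; apply/fpsP => m; apply/fpsP => q; rewrite /swap.
  by rewrite fps1E; case: m q => [|m] [|q]; rewrite ?coef1 ?coef0.
rewrite !fpsME fps_sumE coef_sum.
under eq_bigr do rewrite coefM.
by rewrite exchange_big.
Qed.
HB.instance Definition _ :=
  GRing.isZmodMorphism.Build (fps {poly R}) (fps (fps R)) swap swap_zmod.
HB.instance Definition _ :=
  GRing.isMonoidMorphism.Build (fps {poly R}) (fps (fps R)) swap swap_monoid.

End Swap.

Section DegreeBound.
Variable R : comNzRingType.
Implicit Types x y : fps {poly R}.

(** Used in two readings: the coefficient of gamma^m has degree at most m in delta^2, which gives
    the stencil width; the coefficient of d^m has degree at most m in gamma, which gives
    consistency. *)
Definition slow x := forall m, (size (x m) <= m.+1)%N.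

Lemma slow_cst a : slow (fps_cst a%:P).
Proof. by case=> [|m] /=; rewrite ?size_polyC ?size_poly0 //; case: (_ != _). Qed.

Lemma slow1 : slow 1. Proof. by have := slow_cst 1; rewrite !rmorph1. Qed.

Lemma slowD x y : slow x -> slow y -> slow (x + y).
Proof. by move=> sx sy m; rewrite fpsDE (leq_trans (size_polyD _ _)) // geq_max sx sy. Qed.

Lemma slowM x y : slow x -> slow y -> slow (x * y).
Proof.
move=> sx sy m; rewrite fpsME; apply: (leq_trans (size_sum _ _ _)).
apply/bigmax_leqP => i _; apply: (leq_trans (size_polyMleq _ _)).
have := sx i; have := sy (m - i)%N; have := ltn_ord i; lia.
Qed.

Lemma slowN x : slow x -> slow (- x).
Proof. by move=> sx m; rewrite fpsNE size_polyN. Qed.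

Lemma slow_exp x n : slow x -> slow (x ^+ n).
Proof. by move=> sx; elim: n => [|n IH]; [exact: slow1 | rewrite exprS; apply: slowM]. Qed.

Lemma slow_comp (c : fps R) x : slow x -> slow (fps_comp (@polyC R) c x).
Proof.
move=> sx m; apply: (leq_trans (size_sum _ _ _)).
apply/bigmax_leqP => i _; rewrite mul_polyC.
by apply: (leq_trans (size_scale_leq _ _)); apply: slow_exp.
Qed.

End DegreeBound.

(** * The dispersion equation and its formal solution *)

Section Dispersion.
Variables (R : realType) (theta : R).

Section Equation.
Variables (L : comNzRingType) (I : nat -> L -> Prop) (iota : {rmorphism R -> L}).

(** Here [g] is gamma and [x] is delta^2. The quotient [disp_num / disp_den] is the square of the
    bracket of the statement, with mu^2 replaced by 1 + delta^2 / 4. *)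
Definition disp_num (g x : L) : L :=
  iota 4^-1 * g ^+ 2 * x * (1 + iota ((1 - theta ^+ 2) / 4) * x).
Definition disp_den (g x : L) : L :=
  1 + iota 2^-1 * g * x - iota ((theta ^+ 2 + 1) / 4) * g ^+ 2 * x.

(* [y] stands for [T H^2 / 4]: it is the solution of
   [sinh (sqrt y) ^ 2 = disp_num / disp_den]. *)
Definition dispersion (g x y : L) : Prop :=
  exists2 s, disp_den g x * s = disp_num g x
           & I 1%N y /\ evaluates I iota (sinh2 R) y s.

Lemma dispersion_uniq g x y y' u : filtered I -> disp_den g x * u = 1 ->
  dispersion g x y -> dispersion g x y' -> y = y'.
Proof.
move=> FI du [s ds [y1 sy]] [s' ds' [y1' sy']].
apply: (evaluates_inj FI (sinh2_coef1 R) y1 y1' sy).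
suff -> : s = s' by [].
by rewrite -[s]mul1r -[s']mul1r -du mulrAC ds -ds' mulrAC.
Qed.

End Equation.

Lemma dispersion_morph (L L' : comNzRingType) (I : nat -> L -> Prop)
    (I' : nat -> L' -> Prop) (iota : {rmorphism R -> L})
    (iota' : {rmorphism R -> L'}) (phi : {rmorphism L -> L'}) g x y :
  (forall N z, I N z -> I' N (phi z)) -> (forall a, phi (iota a) = iota' a) ->
  dispersion I iota g x y -> dispersion I' iota' (phi g) (phi x) (phi y).
Proof.
move=> II' ii' [s ds [y1 sy]]; exists (phi s); last first.
  by split; [apply: II' | apply: evaluates_morph sy].
have := congr1 phi ds.
by rewrite /disp_den /disp_num !(rmorphM, rmorphB, rmorphD, rmorphXn, rmorph1) /= !ii'.
Qed.

Section Solution.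
Variables (A : comNzRingType) (iota : {rmorphism R -> A}).
Notation iota' := (@fps_cst A \o iota).
Let F := adic_filtered A.

Lemma fps_unit (d : fps A) :
  d 0%N = 1 -> d * fps_comp iota (inv1p_coef R) (d - 1) = 1.
Proof.
move=> d0; have d1 : adic 1 (d - 1) by apply: adic1; rewrite fpsBE d0 subrr.
apply: (evaluates_uniq F (iota := iota') (z := d - 1)
  (c := (inv1p_coef R : fps R) * (1 + fpsX))); last first.
  by rewrite inv1pM; exact: (evaluates1 F).
rewrite [d * _]mulrC; apply: (evaluatesM F) => //; first exact: fps_compP.
have {2}-> : d = 1 + (d - 1) by rewrite addrC subrK.
by apply: (evaluatesD F); [exact: (evaluates1 F) | exact: (evaluatesX F)].
Qed.

Definition disp_sigma (g x : fps A) : fps A :=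
  disp_num iota' g x * fps_comp iota (inv1p_coef R) (disp_den iota' g x - 1).

Definition disp_sol (g x : fps A) : fps A :=
  fps_comp iota (asinh2 R) (disp_sigma g x).

Lemma disp_den_coef0 (g x : fps A) : g 0%N * x 0%N = 0 -> disp_den iota' g x 0%N = 1.
Proof.
move=> gx; have -> : disp_den iota' g x =
    1 + g * x * (iota' 2^-1 - iota' ((theta ^+ 2 + 1) / 4) * g).
  by rewrite /disp_den; ring.
by rewrite fpsDE fps1E !fpsM_coef0 gx mul0r addr0.
Qed.

Lemma disp_sigma_coef0 (g x : fps A) : g 0%N * x 0%N = 0 -> disp_sigma g x 0%N = 0.
Proof.
move=> gx; rewrite /disp_sigma fpsM_coef0.
have -> : disp_num iota' g x =
    g * x * (iota' 4^-1 * g * (1 + iota' ((1 - theta ^+ 2) / 4) * x)).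
  by rewrite /disp_num; ring.
by rewrite !fpsM_coef0 gx !mul0r.
Qed.

(** The hypothesis lets either [g] or [x] carry the formal variable: in both cases the denominator
    has constant term 1 and the quotient has constant term 0. *)
Lemma disp_solP (g x : fps A) : g 0%N * x 0%N = 0 ->
  dispersion (@adic A) iota' g x (disp_sol g x).
Proof.
move=> gx; exists (disp_sigma g x).
  by rewrite /disp_sigma mulrCA fps_unit ?mulr1 // disp_den_coef0.
have s1 : adic 1 (disp_sigma g x) by apply: adic1; exact: disp_sigma_coef0.
have es := fps_compP iota (asinh2 R) s1.
split; first exact: (evaluates_coef0 s1 es (asinh2_coef0 R)).
exact: (evaluates_comp F s1 (@asinh2K R) es (evaluatesX F _ s1)).
Qed.

End Solution.

Lemma slow_disp_sol (g x : fps {poly R}) : slow (g * x) ->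
  slow (g ^+ 2 * x) -> slow (g ^+ 2 * x ^+ 2) ->
  slow (disp_sol (@polyC R) g x).
Proof.
move=> s1 s2 s22; apply/slow_comp/slowM.
  rewrite /disp_num /=.
  set a := fps_cst _; set b := fps_cst _.
  have -> : a * g ^+ 2 * x * (1 + b * x) = a * (g ^+ 2 * x) + a * b * (g ^+ 2 * x ^+ 2) by ring.
  apply: slowD; apply: slowM => //; first exact: slow_cst.
  by apply: slowM; exact: slow_cst.
apply: slow_comp; rewrite /disp_den /=.
set a := fps_cst 2^-1%:P; set b := fps_cst _.
have -> : 1 + a * g * x - b * g ^+ 2 * x - 1 = a * (g * x) - b * (g ^+ 2 * x) by ring.
by apply: slowD; last apply: slowN; apply: slowM => //; exact: slow_cst.
Qed.

End Dispersion.

(** * The operator formula *)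

Section OperatorSeries.
Variable R : realType.
Notation series := (fps (fps R)).

Definition bidegree N (f : series) :=
  forall m q, (m + q < N)%N -> coef2 f m q = 0.

Lemma coef2M (f g : series) m q : coef2 (f * g) m q =
  \sum_(i < m.+1) \sum_(j < q.+1) coef2 f i j * coef2 g (m - i) (q - j).
Proof. by rewrite /coef2 fpsME fps_sumE. Qed.

Lemma bidegree_filtered : filtered bidegree.
Proof.
split=> //.
- by move=> N x y xN yN m q h; have := xN _ _ h; have := yN _ _ h;
    rewrite /coef2 fpsDE fpsDE => -> ->; rewrite addr0.
- move=> a b x y xa yb m q h; rewrite coef2M big1 // => i _; rewrite big1 // => j _.
  case: (ltnP (i + j) a) => ij; first by rewrite xa ?mul0r.
  by rewrite yb ?mulr0 //; have := ltn_ord i; have := ltn_ord j; lia.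
- by move=> N x xN m q h; apply: xN; apply: ltnW.
- move=> x xN; apply/fpsP => m; apply/fpsP => q; exact: (xN (m + q).+1).
Qed.
Let F := bidegree_filtered.

Notation scal2 := (@fps_cst (fps R) \o @fps_cst R).

Lemma scalE a : scal a = scal2 a. Proof. by []. Qed.

Lemma substP c (z : series) : bidegree 1 z -> evaluates bidegree scal2 c z (subst c z).
Proof.
move=> z1 N m q mq; rewrite /coef2 !fpsBE !fps_sumE; apply/eqP; rewrite subr_eq0.
apply/eqP; under [RHS]eq_bigr do rewrite fps_cstM fps_cstM.
rewrite /subst -!(big_mkord xpredT (fun n => c n * (z ^+ n) m q)).
rewrite [RHS](@big_cat_nat _ _ _ (m + q).+1 0 N) //=.
rewrite [X in _ = _ + X]big_nat_cond [X in _ = _ + X]big1 ?addr0 //.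
move=> i /andP[/andP[mi _] _].
by rewrite [(z ^+ i) m q](fil_exp F i z1) ?mulr0.
Qed.

Definition exps (a : R) : fps R := fun q => a ^+ q / q`!%:R.

Lemma expsD a b : exps (a + b) = exps a * exps b.
Proof.
apply/fpsP => q; rewrite fpsME /exps exprDn mulr_suml.
rewrite [RHS](reindex_inj rev_ord_inj) /=; apply: eq_bigr => i _.
have iq : (i <= q)%N by rewrite -ltnS.
rewrite subSS subKn // -mulr_natr.
have := bin_fact iq => /(congr1 (fun n => n%:R : R)); rewrite !natrM.
have f0 n : n`!%:R != 0 :> R by rewrite pnatr_eq0 -lt0n fact_gt0.
have := f0 q; have := f0 i; have := f0 (q - i)%N.
move: (q`!%:R) (i`!%:R) ((q - i)`!%:R) ('C(q, i)%:R) => u v w s w0 v0 u0 E.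
move: u0; rewrite -E !mulf_eq0 !negb_or => /andP[s0 _].
by field; rewrite s0 v0 w0.
Qed.

Lemma exps0 : exps 0 = 1.
Proof.
by apply/fpsP => -[|n]; rewrite /exps fps1E ?expr0 ?fact0 ?divr1 // expr0n /= mul0r.
Qed.

Variables (H theta : R).

Definition dlt : fps R := exps (H / 2) - exps (- (H / 2)).

Lemma deltaE : delta H = fps_cst dlt.
Proof. by rewrite /dlt rmorphB. Qed.

Lemma dlt0 : dlt 0%N = 0. Proof. by rewrite /dlt fpsBE /exps !expr0 subrr. Qed.

Lemma mu_sqr : mu H ^+ 2 = 1 + scal2 4^-1 * delta H ^+ 2.
Proof.
rewrite /mu /delta -[Eshift (H / 2)]/(fps_cst (exps (H / 2))).
rewrite -[Eshift (- (H / 2))]/(fps_cst (exps (- (H / 2)))) scalE.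
have : fps_cst (exps (H / 2)) * fps_cst (exps (- (H / 2))) = 1.
  by rewrite -rmorphM -expsD subrr exps0 rmorph1.
have -> : scal2 4^-1 = scal2 2^-1 ^+ 2 :> series.
  by rewrite -rmorphXn /=; congr (fps_cst (fps_cst _)); field.
have : 2 * scal2 2^-1 = 1 :> series.
  have -> : 2 = scal2 2 :> series by rewrite rmorph_nat.
  by rewrite -rmorphM mulfV ?pnatr_eq0 // rmorph1.
move: (scal2 2^-1) (fps_cst (exps (H / 2))) (fps_cst (exps (- (H / 2)))) => a e f E1 E2.
transitivity ((2 * a) ^+ 2 * (e * f) + a ^+ 2 * (e - f) ^+ 2); first by ring.
by rewrite E1 E2; ring.
Qed.

Lemma series_invP (f : series) : bidegree 1 (f - 1) -> f * series_inv f = 1.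
Proof.
move=> f1; apply: (evaluates_uniq F (iota := scal2) (z := f - 1)
  (c := (inv1p_coef R : fps R) * (1 + fpsX))); last first.
  by rewrite inv1pM; exact: (evaluates1 F).
rewrite [f * _]mulrC; apply: (evaluatesM F) => //; first exact: substP.
have {2}-> : f = 1 + (f - 1) by rewrite addrC subrK.
by apply: (evaluatesD F); [exact: (evaluates1 F) | exact: (evaluatesX F)].
Qed.

Lemma series_sqrtP (f : series) : bidegree 1 (f - 1) -> series_sqrt f ^+ 2 = f.
Proof.
move=> f1; apply: (evaluates_uniq F (iota := scal2) (z := f - 1)
  (c := (sqrt1p_coef R : fps R) ^+ 2)).
  by apply: (evaluates_exp F) => //; exact: substP.
rewrite sqrt1pM; have {2}-> : f = 1 + (f - 1) by rewrite addrC subrK.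
by apply: (evaluatesD F); [exact: (evaluates1 F) | exact: (evaluatesX F)].
Qed.

Lemma series_asinhP (z : series) : bidegree 1 z ->
  evaluates bidegree scal2 (sinh2 R) (series_asinh z ^+ 2) (z ^+ 2).
Proof.
move=> z1; have az := evaluates_exp F 2 z1 (substP (asinh_coef R) z1).
exact: (evaluates_comp F z1 (@asinhK R) az (evaluates_exp F 2 z1 (evaluatesX F _ z1))).
Qed.

Lemma gammaE : @gamma R = fpsX.
Proof. by apply/fpsP => -[|[|n]]. Qed.

Lemma bidegree_gamma : bidegree 1 (@gamma R).
Proof. by case=> [|m] [|q]. Qed.

Lemma bidegree_delta2 : bidegree 1 (delta H ^+ 2).
Proof.
rewrite deltaE -rmorphXn => -[|m] [|q] // _.
by rewrite /coef2 /= fpsX_coef0 dlt0 expr0n.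
Qed.

(** Squaring the bracket removes the formal square root, and [sinh2] undoes the asinh. *)
Lemma dispersion_bracket :
  dispersion theta bidegree scal2 fpsX (delta H ^+ 2)
    (series_asinh (bracket H theta) ^+ 2).
Proof.
set den := 1 + scal 2^-1 * gamma R * delta H ^+ 2
           - scal ((theta ^+ 2 + 1) / 4) * gamma R ^+ 2 * delta H ^+ 2.
have denE : disp_den theta scal2 fpsX (delta H ^+ 2) = den.
  by rewrite /disp_den -gammaE.
have g1 := bidegree_gamma; have d1 := bidegree_delta2.
have den1 : bidegree 1 (den - 1).
  have -> : den - 1 = gamma R * (delta H ^+ 2 * (scal 2^-1 - scal ((theta ^+ 2 + 1) / 4) * gamma R)).
    by rewrite /den; ring.
  exact: (filMr F).
have dinv := series_invP den1.
set num := mu H ^+ 2 - scal (theta ^+ 2 / 4) * delta H ^+ 2.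
have numE : num = 1 + scal2 ((1 - theta ^+ 2) / 4) * delta H ^+ 2.
  rewrite /num mu_sqr scalE mulrBl mul1r rmorphB /=; ring.
have q1 : bidegree 1 (num * series_inv den - 1).
  have -> : num * series_inv den - 1 =
      (num - 1) * series_inv den - (den - 1) * series_inv den.
    by rewrite -[X in _ - X = _]dinv; ring.
  apply: (filB F); apply: (filMr F) => //.
  rewrite numE addrC addKr; exact: (filMl F).
have b1 : bidegree 1 (bracket H theta).
  rewrite /bracket; apply: (filMl F); apply: (filMr F); exact: (filMr F).
exists (bracket H theta ^+ 2); last first.
  split; last exact: series_asinhP.
  rewrite expr2; apply: (filMr F).
  exact: (evaluates_coef0 b1 (substP (asinh_coef R) b1)).
rewrite /bracket -/num -/den [in X in _ * X]exprMn series_sqrtP // denE.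
rewrite /disp_num -numE -gammaE /= /scal.
have -> : fps_cst (fps_cst 4^-1) = fps_cst (fps_cst 2^-1) ^+ 2 :> series.
  by rewrite -!rmorphXn /=; congr (fps_cst (fps_cst _)); field.
set a := fps_cst (fps_cst 2^-1).
transitivity (den * series_inv den * (num * (gamma R * delta H * a) ^+ 2)); first ring.
by rewrite dinv; ring.
Qed.

(** By uniqueness, a solution computed in any other ring and mapped here is the operator of the
    statement up to the factor 4 / H^2. This identifies [T_poly] and [T_swap] with it. *)
Lemma dispersion_eq y : dispersion theta bidegree scal2 fpsX (delta H ^+ 2) y ->
  T_formula H theta = scal2 (4 / H ^+ 2) * y.
Proof.
move=> hy; rewrite /T_formula scalE; congr (_ * _).
have den1 : bidegree 1 (disp_den theta scal2 fpsX (delta H ^+ 2) - 1).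
  set d := delta H ^+ 2.
  have -> : disp_den theta scal2 fpsX d - 1
    = fpsX * (d * (scal2 2^-1 - scal2 ((theta ^+ 2 + 1) / 4) * fpsX)).
    by rewrite /disp_den; ring.
  apply: (filMr F); rewrite -gammaE; exact: bidegree_gamma.
exact: (dispersion_uniq F (series_invP den1) dispersion_bracket).
Qed.

Lemma delta2E : fps_cst (dlt ^+ 2) = delta H ^+ 2.
Proof. by rewrite deltaE rmorphXn. Qed.

(** The solution as a series in gamma with coefficients polynomial in delta^2, for which 'X
    stands. *)
Definition y_poly : fps {poly R} := disp_sol theta (@polyC R) fpsX (fps_cst 'X).
Definition T_poly : fps {poly R} := fps_cst (4 / H ^+ 2)%:P * y_poly.

Definition poly_at (e : fps R) := horner_eval e \o map_poly (@fps_cst R).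

Lemma poly_atE e p q : poly_at e p q = \sum_(i < size p) p`_i * (e ^+ i) q.
Proof.
rewrite /poly_at /= /horner_eval horner_coef fps_sumE size_map_poly.
by apply: eq_bigr => i _; rewrite coef_map /= fps_cstM.
Qed.

Lemma T_polyP : T_formula H theta = fps_map (poly_at (dlt ^+ 2)) T_poly.
Proof.
have ii a : fps_map (poly_at (dlt ^+ 2)) (fps_cst a%:P) = scal2 a.
  by rewrite fps_map_cst /poly_at /= map_polyC /= /horner_eval hornerC.
rewrite /T_poly rmorphM /= ii; apply: dispersion_eq.
have X0 : (fpsX : fps {poly R}) 0%N * (fps_cst 'X : fps {poly R}) 0%N = 0.
  by rewrite /fpsX mul0r.
have := dispersion_morph (I' := bidegree) (iota' := scal2)
  (phi := fps_map (poly_at (dlt ^+ 2))) _ _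
  (@disp_solP R theta _ (@polyC R) _ _ X0).
rewrite /= fps_mapX fps_map_cst {2}/poly_at /= map_polyX /horner_eval hornerX.
rewrite delta2E; apply=> [N z zN m q mq|]; last exact: ii.
by rewrite /coef2 /fps_map zN ?rmorph0 //; lia.
Qed.

(** The same solution as a series in d with coefficients polynomial in gamma, for which 'X now
    stands, so that gamma = 1 makes sense. *)
Definition y_swap : fps {poly R} :=
  disp_sol theta (@polyC R) (fps_cst 'X) (fps_map (@polyC R) (dlt ^+ 2)).
Definition T_swap : fps {poly R} := fps_cst (4 / H ^+ 2)%:P * y_swap.

Lemma dlt2_swap0 : (fps_map (@polyC R) (dlt ^+ 2)) 0%N = 0.
Proof. by rewrite /fps_map fpsX_coef0 dlt0 expr0n /= polyC0. Qed.

Lemma swap_cst_polyC (e : fps R) : swap (fps_map (@polyC R) e) = fps_cst e.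
Proof.
by apply/fpsP => m; apply/fpsP => q; rewrite /swap /fps_map coefC; case: m.
Qed.

Lemma dispersion_y_swap : dispersion theta (@adic _) (@fps_cst _ \o @polyC R)
  (fps_cst 'X) (fps_map (@polyC R) (dlt ^+ 2)) y_swap.
Proof. by apply: disp_solP; rewrite dlt2_swap0 mulr0. Qed.

Lemma T_swapP : T_formula H theta = swap T_swap.
Proof.
have ii a : swap (fps_cst a%:P) = scal2 a.
  by rewrite -fps_map_cst swap_cst_polyC.
rewrite /T_swap rmorphM /= ii; apply: dispersion_eq.
have := dispersion_morph (I' := bidegree) (iota' := scal2) (phi := @swap R) _ _
  dispersion_y_swap.
rewrite /= swap_cst_polyC delta2E.
have -> : swap (fps_cst 'X) = fpsX :> fps (fps R).
  apply/fpsP => m; apply/funext => q; rewrite /swap /fpsX.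
  case: q => [|q]; rewrite ?coefX ?coef0; case: m => [|[|m]] //=.
apply=> [N z zN m q mq|]; last exact: ii.
by rewrite /coef2 /swap zN ?coef0 //; lia.
Qed.

Lemma slow_T_poly : slow T_poly.
Proof.
apply: slowM; first exact: slow_cst.
have E k (p : {poly R}) : fpsX ^+ k * fps_cst p = (fun n => if n == k then p else 0).
  apply/fpsP => n; rewrite fpsXnM; case: ltngtP => // h.
    by rewrite -(subnSK h).
  by rewrite h subnn.
apply: slow_disp_sol.
- by rewrite -[fpsX]expr1 E => m; case: eqP => [->|]; rewrite ?size_polyX ?size_poly0.
- by rewrite E => m; case: eqP => [->|]; rewrite ?size_polyX ?size_poly0.
- by rewrite -rmorphXn /= E => m; case: eqP => [->|]; rewrite ?size_polyXn ?size_poly0.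
Qed.

Lemma slow_cst_map (p : {poly R}) (e : fps R) N :
  adic N e -> (size p <= N.+1)%N -> slow (fps_cst p * fps_map (@polyC R) e).
Proof.
move=> eN pN q; rewrite fps_cstM /fps_map /= mulrC mul_polyC.
case: (ltnP q N) => qN; first by rewrite eN // scale0r size_poly0.
by rewrite (leq_trans (size_scale_leq _ _)) // (leq_trans pN).
Qed.

Lemma adic_dlt2 : adic 2 (dlt ^+ 2).
Proof. by apply: adic_exp; apply: adic1; exact: dlt0. Qed.

(** As delta^2 has order 2 in d, each of gamma delta^2, gamma^2 delta^2 and gamma^2 delta^4 has a
    degree in gamma not exceeding its order in d. *)
Lemma slow_T_swap : slow T_swap.
Proof.
apply: slowM; first exact: slow_cst.
apply: slow_disp_sol; rewrite -?[_ ^+ 2]rmorphXn -?rmorphXn /=.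
- by apply: (slow_cst_map adic_dlt2); rewrite size_polyX.
- by apply: (slow_cst_map adic_dlt2); rewrite size_polyXn.
- apply: (@slow_cst_map _ _ 4); last by rewrite size_polyXn.
  by rewrite expr2; exact: (adicM adic_dlt2 adic_dlt2).
Qed.

Lemma adic_T_poly : adic 1 T_poly.
Proof.
apply: (filMl (adic_filtered _)); apply: adic1.
rewrite /y_poly /disp_sol /fps_comp big_ord1 /= asinh2_coef0 polyC0 mul0r //.
Qed.

Lemma coef2_T_poly k m q :
  coef2 (T_formula H theta ^+ k) m q = poly_at (dlt ^+ 2) ((T_poly ^+ k) m) q.
Proof. by rewrite T_polyP -rmorphXn. Qed.

Lemma fps_comp_monomial (c : R) (f : fps R) n :
  fps_comp idfun f (fps_cst c * fpsX ^+ 2) n =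
  if odd n then 0 else c ^+ n./2 * f n./2.
Proof.
rewrite /fps_comp.
under eq_bigr do rewrite exprMn -exprM -rmorphXn fps_cstM fpsXn mul2n /=.
case: ifPn => on.
  rewrite big1 // => i _; case: eqP => [E|]; rewrite ?mulr0 //.
  by rewrite E odd_double in on.
have n2 : (n./2 < n.+1)%N by lia.
rewrite (bigD1 (Ordinal n2)) //= even_halfK // eqxx mulr1 big1 ?addr0 1?mulrC //.
move=> i; rewrite -val_eqE /= => ni.
case: eqP => [E|]; rewrite ?mulr0 //.
by case/eqP: ni; rewrite -[LHS]doubleK -E.
Qed.

(** The odd part of exp (H d / 2) is sinh (H d / 2) = delta / 2, and it equals (H d / 2) [sh] ((H d
    / 2)^2); the claim is its square. *)
Lemma sinh2_half_step :
  evaluates (@adic R) (@fps_cst R) (sinh2 R) (fps_cst ((H / 2) ^+ 2) * fpsX ^+ 2)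
    (fps_cst 4^-1 * dlt ^+ 2).
Proof.
set x := fps_cst _ * _.
have F1 := adic_filtered R.
have x1 : adic 1 x by apply: (filMl F1) => n; rewrite fpsXn; case: n.
pose s := fps_comp idfun (sh R) x.
have es : evaluates (@adic R) (@fps_cst R) (sh R) x s := fps_compP idfun _ x1.
have E : fps_cst (H / 2) * fpsX * s = fps_cst 2^-1 * dlt.
  apply/fpsP => n; rewrite -mulrA !fps_cstM fpsXM /dlt fpsBE /exps.
  case: n => [|n]; first by rewrite !expr0 subrr !mulr0.
  rewrite /s /x fps_comp_monomial exprNn; case: ifPn => on.
    by rewrite /= -signr_odd /= on expr0 mul1r subrr !mulr0.
  rewrite -signr_odd /= on expr1 mulN1r mulNr opprK -exprM mul2n even_halfK //.
  rewrite /sh even_halfK // exprS.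
  have : n.+1`!%:R != 0 :> R by rewrite pnatr_eq0 -lt0n fact_gt0.
  by move: (_`!%:R) => f f0; field.
have -> : fps_cst 4^-1 * dlt ^+ 2 = x * s ^+ 2.
  have -> : 4^-1 = 2^-1 ^+ 2 :> R by field.
  by rewrite rmorphXn -exprMn -E /x rmorphXn; ring.
exact: (evaluatesM F1 x1 (evaluatesX F1 _ x1) (evaluates_exp F1 2 x1 es)).
Qed.

Notation at1 := (fps_map (horner_eval (1 : R))).

Lemma T_swap_at1 : H != 0 -> at1 T_swap = fpsX ^+ 2.
Proof.
move=> H0.
have ii a : at1 (fps_cst a%:P) = fps_cst a.
  by rewrite fps_map_cst /= /horner_eval hornerC.
have F1 := adic_filtered R.
have pe (e : fps R) : at1 (fps_map (@polyC R) e) = e.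
  by apply/fpsP => n; rewrite /fps_map /= /horner_eval hornerC.
have x1 : adic 1 (fps_cst ((H / 2) ^+ 2) * fpsX ^+ 2).
  by apply: (filMl F1) => n; rewrite fpsXn; case: n.
have D : dispersion theta (@adic R) (@fps_cst R) 1 (dlt ^+ 2)
    (fps_cst ((H / 2) ^+ 2) * fpsX ^+ 2).
  exists (fps_cst 4^-1 * dlt ^+ 2); last by split => //; exact: sinh2_half_step.
  rewrite /disp_den /disp_num expr1n !mulr1.
  (* At gamma = 1 the denominator becomes 1 + (1 - theta^2) delta^2 / 4, which is the last factor of
     the numerator; only delta^2 / 4 is left. *)
  have -> : 2^-1 = (1 - theta ^+ 2) / 4 + (theta ^+ 2 + 1) / 4 by field.
  rewrite rmorphD /=; ring.
have D' := dispersion_morph (I' := @adic R) (iota' := @fps_cst R)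
  (phi := at1) _ _ dispersion_y_swap.
have {}D' : dispersion theta (@adic R) (@fps_cst R) 1 (dlt ^+ 2) (at1 y_swap).
  have := D'; rewrite /= pe.
  have -> : at1 (fps_cst 'X) = 1.
    by rewrite fps_map_cst /= /horner_eval hornerX.
  by apply=> [N z zN|]; [exact: adic_map | exact: ii].
have d0 : (1 : fps R) 0%N * (dlt ^+ 2) 0%N = 0 by rewrite fpsX_coef0 dlt0 expr0n mulr0.
have du : disp_den theta (@fps_cst R) 1 (dlt ^+ 2) * _ = 1 :=
  fps_unit idfun (disp_den_coef0 theta idfun d0).
have yE := dispersion_uniq F1 du D D'.
have E : 4 / H ^+ 2 * (H / 2) ^+ 2 = 1 by field.
by rewrite /T_swap rmorphM /= ii -yE mulrA -rmorphM E rmorph1 mul1r.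
Qed.

(** The coefficient of d^q in T^k has degree at most q < p in gamma, so the truncated sum is its
    full value at gamma = 1, where T = d^2. *)
Lemma sum_coef2_T k p q : H != 0 -> (q < p)%N ->
  \sum_(m < p) coef2 (T_formula H theta ^+ k) m q = (q == k.*2)%:R.
Proof.
move=> H0 qp; rewrite T_swapP -rmorphXn /coef2 /swap.
have s : (size ((T_swap ^+ k) q) <= p)%N.
  by apply: (leq_trans (slow_exp k slow_T_swap q)).
have := horner_coef_wide 1 s.
under eq_bigr do rewrite expr1n mulr1.
move=> <-; rewrite -[LHS]/(fps_map (horner_eval 1) (T_swap ^+ k) q).
by rewrite rmorphXn /= T_swap_at1 // -exprM mul2n fpsXn.
Qed.

End OperatorSeries.

(** * Stencils *)

Lemma fsum_window (W : zmodType) (F : int -> W) n :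
  (forall i, (n < absz i)%N -> F i = 0) ->
  \sum_(i \in [set: int]) F i = \sum_(j < n.*2.+1) F (j%:Z - n%:Z).
Proof.
move=> F0; pose h (j : nat) : int := j%:Z - n%:Z.
have uh : uniq [seq h j | j <- iota 0 n.*2.+1].
  by rewrite map_inj_uniq ?iota_uniq // => a b /addIr [].
rewrite (@fsbigE _ _ _ _ _ _ F uh) //.
  rewrite big_map -[n.*2.+1 in LHS]subn0 -(big_mkord xpredT (fun j => F (h j))).
  by apply: eq_bigl => j; rewrite in_setT.
move=> i _ ir; apply: F0; rewrite ltnNge; apply: contra ir => i_n.
apply/mapP; exists (absz (i + n%:Z)); rewrite ?mem_iota /h; lia.
Qed.

Section Stencils.
Variable R : realType.

(* [E^(-k) (E - 1)^(2k)] is the [k]-th power of [delta^2]. *)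
Definition delta2_coef (k : nat) (i : int) : R :=
  if 0 <= k%:Z + i then (('X - 1%:P) ^+ k.*2 : {poly R})`_(absz (k%:Z + i)) else 0.

Definition poly_stencil (p : {poly R}) (i : int) : R :=
  \sum_(k < size p) p`_k * delta2_coef k i.

Lemma delta2_coef_eq0 k i : (k < absz i)%N -> delta2_coef k i = 0.
Proof.
move=> ki; rewrite /delta2_coef; case: ifP => // h.
rewrite nth_default // size_exp_XsubC; lia.
Qed.

Lemma poly_stencil_eq0 n (p : {poly R}) i : (size p <= n.+1)%N -> (n < absz i)%N ->
  poly_stencil p i = 0.
Proof.
move=> pn ni; rewrite /poly_stencil big1 // => k _.
by rewrite delta2_coef_eq0 ?mulr0 //; have := ltn_ord k; lia.
Qed.

Definition zpow (L : comNzRingType) (e f : L) (i : int) : L :=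
  match i with Posz n => e ^+ n | Negz n => f ^+ n.+1 end.

Section Evaluation.
Variables (L : comNzRingType) (iota : {rmorphism R -> L}) (e f : L).
Hypothesis ef : e * f = 1.

Lemma zpow_sub (a b : nat) : zpow e f (a%:Z - b%:Z) = e ^+ a * f ^+ b.
Proof.
have E n : e ^+ n * f ^+ n = 1 by rewrite -exprMn ef expr1n.
case: (leqP b a) => ab.
  rewrite subzn //= -{2}(subnK ab) exprD -mulrA E mulr1 //.
have -> : a%:Z - b%:Z = Negz (b - a).-1 by rewrite NegzE; lia.
rewrite /= prednK ?subn_gt0 // -{2}(subnK (ltnW ab)) exprD mulrCA E mulr1 //.
Qed.

(** Since e f = 1, e - 2 + f = (e - 1)^2 f. Expanding (e - 1)^(2k) and multiplying by f^k shifts all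
    exponents by -k. *)
Lemma delta2_coef_sum n k : (k <= n)%N ->
  \sum_(j < n.*2.+1) iota (delta2_coef k (j%:Z - n%:Z)) * zpow e f (j%:Z - n%:Z)
  = (e - 2 + f) ^+ k.
Proof.
move=> kn; rewrite -(@fsum_window L (fun i => iota (delta2_coef k i) * zpow e f i)); last first.
  by move=> i ni; rewrite delta2_coef_eq0 ?rmorph0 ?mul0r //; lia.
rewrite (@fsum_window _ _ k); last first.
  by move=> i ni; rewrite delta2_coef_eq0 ?rmorph0 ?mul0r.
have -> : e - 2 + f = (e - 1) ^+ 2 * f.
  by transitivity (e * (e * f) - 2 * (e * f) + f); [rewrite ef|]; ring.
rewrite exprMn -exprM mul2n.
set q : {poly R} := ('X - 1%:P) ^+ k.*2.
have <- : (map_poly iota q).[e] = (e - 1) ^+ k.*2.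
  rewrite /q rmorphXn rmorphB /= map_polyX map_polyC /= rmorph1 horner_exp.
  by rewrite hornerXsubC.
have s : (size (map_poly iota q) <= k.*2.+1)%N.
  by rewrite (leq_trans (size_poly _ _)) // size_exp_XsubC.
rewrite (horner_coef_wide _ s) mulr_suml; apply: eq_bigr => j _.
rewrite zpow_sub /delta2_coef coef_map /= mulrA.
by have -> : k%:Z + (j%:Z - k%:Z) = j%:Z by rewrite addrC subrK.
Qed.

(** Valid for any pair of inverse elements: exponentials of H d yield symbols, and cyclic shifts
    yield the action on grid values. *)
Lemma poly_stencil_sum n (p : {poly R}) : (size p <= n.+1)%N ->
  \sum_(j < n.*2.+1) iota (poly_stencil p (j%:Z - n%:Z)) * zpow e f (j%:Z - n%:Z)
  = (map_poly iota p).[e - 2 + f].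
Proof.
move=> pn; rewrite (horner_coef_wide _ (n := size p)); last first.
  exact: size_poly.
under eq_bigr do rewrite rmorph_sum mulr_suml.
rewrite exchange_big /=; apply: eq_bigr => k _.
rewrite coef_map /= -(@delta2_coef_sum n); last by rewrite -ltnS (leq_trans (ltn_ord k)).
by rewrite mulr_sumr; apply: eq_bigr => j _; rewrite rmorphM mulrA.
Qed.

End Evaluation.

Section Symbol.
Variables (H : R).

Lemma exps_exp a n : exps (n%:R * a) = exps a ^+ n :> fps R.
Proof.
elim: n => [|n IH]; first by rewrite mul0r exps0.
by rewrite exprS -IH -expsD -natr1 mulrDl mul1r addrC.
Qed.

Lemma zpow_exps i : zpow (exps H) (exps (- H)) i = exps (i%:~R * H).
Proof.
case: i => n /=; rewrite -exps_exp; congr (exps _).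
by rewrite NegzE rmorphN /= mulrN mulNr.
Qed.

Lemma dlt_sqr : dlt H ^+ 2 = exps H - 2 + exps (- H).
Proof.
rewrite sqrrB -expsD subrr exps0 !expr2 -!expsD -opprD -!splitr.
by [].
Qed.

Lemma poly_stencil_symbol n (p : {poly R}) q : (size p <= n.+1)%N ->
  \sum_(j < n.*2.+1) ((j%:Z - n%:Z)%:~R * H) ^+ q / q`!%:R *
     poly_stencil p (j%:Z - n%:Z) = poly_at (dlt H ^+ 2) p q.
Proof.
move=> pn; have ef : exps H * exps (- H) = 1 :> fps R by rewrite -expsD subrr exps0.
have := poly_stencil_sum (@fps_cst R) ef pn => /(congr1 (fun f : fps R => f q)).
rewrite fps_sumE -dlt_sqr => E.
rewrite -[RHS]/((map_poly (@fps_cst R) p).[dlt H ^+ 2] q) -E.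
apply: eq_bigr => j _.
by rewrite zpow_exps fps_cstM mulrC.
Qed.

End Symbol.

(** * The stencils of the scheme: expansion, width and consistency *)

Section Scheme.
Variables (V : lmodType R) (K : nat -> {linear V -> V}) (H theta : R).

(** The sum stops at k = m because T = O(gamma). *)
Definition holistic_stencil (m : nat) : stencil V := fun i u =>
  (if (m == 0%N) && (i == 0) then K 0%N u else 0) +
  \sum_(1 <= k < m.+1) poly_stencil ((T_poly H theta ^+ k) m) i *: K k u.

Lemma size_T_poly k m : (size ((T_poly H theta ^+ k) m) <= m.+1)%N.
Proof. exact: (slow_exp k (slow_T_poly H theta)). Qed.

Lemma T_poly_eq0 k m : (m < k)%N -> (T_poly H theta ^+ k) m = 0.
Proof. exact: (adic_exp (n := k) (adic_T_poly H theta)). Qed.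

Lemma coef2_T_eq0 k m q : (m < k)%N -> coef2 (T_formula H theta ^+ k) m q = 0.
Proof. by move=> mk; rewrite coef2_T_poly T_poly_eq0 // poly_atE size_poly0 big_ord0. Qed.

Lemma holistic_stencil_eq0 m i u : (m < absz i)%N -> holistic_stencil m i u = 0.
Proof.
move=> mi; rewrite /holistic_stencil ifF ?add0r; last first.
  by apply/negP => /andP[/eqP ? /eqP ?]; subst; move: mi.
by rewrite big1 // => k _; rewrite (poly_stencil_eq0 _ mi) ?scale0r ?size_T_poly.
Qed.

Lemma finite_window (P : set int) n : (forall i, P i -> (absz i <= n)%N) -> finite_set P.
Proof.
move=> Pn; apply: (@sub_finite_set _ _ [set` [seq j%:Z - n%:Z | j <- iota 0 n.*2.+1]]).
  move=> i /Pn i_n; apply/(@mapP _ _ (fun j : nat => j%:Z - n%:Z)); exists (absz (i + n%:Z)); rewrite ?mem_iota; lia.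
exact: finite_seq.
Qed.

Lemma finite_holistic_stencil m : finite_stencil (holistic_stencil m).
Proof.
apply: (@finite_window _ m) => i [u /eqP Su]; rewrite leqNgt; apply/negP => mi.
by apply: Su; rewrite holistic_stencil_eq0.
Qed.

Lemma symbol_window n (c : stencil V) q u : (forall i, (n < absz i)%N -> c i u = 0) ->
  symbol H c q u = \sum_(j < n.*2.+1)
     (((j%:Z - n%:Z)%:~R * H) ^+ q / q`!%:R) *: c (j%:Z - n%:Z) u.
Proof.
move=> c0; rewrite /symbol.
by rewrite (@fsum_window _ _ n) // => i /c0 ->; rewrite scaler0.
Qed.

(** The formula lets k run up to m + q, but the terms with k > m vanish as T = O(gamma). A bound
    independent of m and q allows the sums over k and m to be exchanged. *)
Lemma formula_coef_wide N m q u : (m < N)%N ->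
  formula_coef K H theta m q u =
  (if (m == 0%N) && (q == 0%N) then K 0%N u else 0)
  + \sum_(1 <= k < N) coef2 (T_formula H theta ^+ k) m q *: K k u.
Proof.
move=> mN; rewrite /formula_coef; congr (_ + _).
have E N' : (m < N')%N -> \sum_(1 <= k < N') coef2 (T_formula H theta ^+ k) m q *: K k u
   = \sum_(1 <= k < m.+1) coef2 (T_formula H theta ^+ k) m q *: K k u.
  move=> mN'; rewrite (@big_cat_nat _ _ _ m.+1) //= [X in _ + X]big_nat_cond.
  rewrite [X in _ + X]big1 ?addr0 // => k /andP[/andP[mk _] _].
  by rewrite coef2_T_eq0 ?scale0r.
by rewrite !E // ltnS leq_addr.
Qed.

Lemma symbol_holistic_stencil m q u :
  symbol H (holistic_stencil m) q u = formula_coef K H theta m q u.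
Proof.
rewrite (symbol_window _ (n := m)); last first.
  by move=> i mi; rewrite holistic_stencil_eq0.
rewrite (@formula_coef_wide m.+1) //.
under eq_bigr do rewrite scalerDr scaler_sumr.
rewrite big_split exchange_big /=; congr (_ + _).
  case: eqP => [->|_] /=; last by rewrite big1 // => j _; rewrite scaler0.
  (* For m = 0 the only offset is 0, and 0^q is 1 exactly for q = 0. *)
  rewrite big_ord1 /= subrr mul0r expr0n; case: eqP => [->|_].
    by rewrite fact0 divr1 scale1r.
  by rewrite mul0r scale0r.
apply: eq_bigr => k _.
under eq_bigr do rewrite scalerA.
by rewrite -scaler_suml poly_stencil_symbol ?size_T_poly // coef2_T_poly.
Qed.

Lemma holistic_stencil_width p g : (0 < p)%N ->
  has_stencil_width (2 * p).-1 (truncation p g holistic_stencil).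
Proof.
move=> p0 i u wi; rewrite /truncation big1 // => m _.
by rewrite holistic_stencil_eq0 ?scaler0 //; have := ltn_ord m; lia.
Qed.

Lemma holistic_stencil_consistent p : H != 0 -> (0 < p)%N ->
  consistent_to K H p (truncation p 1 holistic_stencil).
Proof.
move=> H0 p0 q u qp.
have E : symbol H (truncation p 1 holistic_stencil) q u =
         \sum_(m < p) formula_coef K H theta m q u.
  rewrite (symbol_window _ (n := p)); last first.
    move=> i pi; rewrite /truncation big1 // => m _.
    by rewrite holistic_stencil_eq0 ?scaler0 //; have := ltn_ord m; lia.
  under eq_bigr do rewrite scaler_sumr.
  rewrite exchange_big /=; apply: eq_bigr => m _.
  rewrite -symbol_holistic_stencil (symbol_window _ (n := p)); last first.
    by move=> i pi; rewrite holistic_stencil_eq0 //; have := ltn_ord m; lia.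
  by apply: eq_bigr => j _; rewrite expr1n scale1r.
rewrite E; under eq_bigr do rewrite (@formula_coef_wide p.+1) ?ltnS 1?ltnW//.
rewrite big_split exchange_big /=.
(* After summation over m the coefficients of T^k are those of d^(2k), so at most the term k = q / 2
   survives. *)
under [X in _ + X]eq_bigr do rewrite -scaler_suml sum_coef2_T //.
rewrite /pde_coef; case: p p0 qp {E} => // p _ qp.
rewrite big_ord_recl /= big1 ?addr0 //.
case: (eqVneq q 0%N) => [->|q0] /=.
  rewrite big_nat_cond big1 ?addr0 // => k /andP[/andP[k0 _] _].
  by rewrite eq_sym double_eq0 gtn_eqF // scale0r.
rewrite add0r; case: ifPn => oq.
  rewrite big1 // => k _; case: eqP => [qk|]; rewrite ?scale0r //.
  by rewrite qk odd_double in oq.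
rewrite (bigD1_seq q./2) ?iota_uniq ?mem_index_iota //=; last by lia.
rewrite even_halfK // eqxx scale1r big1 ?addr0 // => k kq.
case: eqP => [qk|]; rewrite ?scale0r //.
by case/eqP: kq; rewrite qk doubleK.
Qed.

Lemma holistic_stencil_expands : expands_formula K H theta holistic_stencil.
Proof. by split; [exact: finite_holistic_stencil | exact: symbol_holistic_stencil]. Qed.

End Scheme.
End Stencils.

(** * Operators on a cyclic grid *)

Section Bicommutant.
Variables (Q : nzRingType) (s : Q).

(* The bicommutant of the shift matrix provides a commutative ring that contains
   the shift and its inverse. *)
Definition bicomm : {pred Q} :=
  fun a => `[< forall x : Q, x * s = s * x -> x * a = a * x >].

Lemma bicommP a : reflect (forall x : Q, x * s = s * x -> x * a = a * x) (a \in bicomm).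
Proof. exact: asboolP. Qed.

Fact bicomm_subring : subring_closed bicomm.
Proof.
split; first by apply/bicommP => x _; rewrite mulr1 mul1r.
  move=> a b /bicommP ha /bicommP hb; apply/bicommP => x xs.
  by rewrite mulrBr mulrBl ha // hb.
move=> a b /bicommP ha /bicommP hb; apply/bicommP => x xs.
by rewrite mulrA ha // -mulrA hb // mulrA.
Qed.
HB.instance Definition _ := GRing.isSubringClosed.Build Q bicomm bicomm_subring.

Record bicommutant := Bicommutant {
  bival :> Q; _ : bival \in bicomm }.
HB.instance Definition _ := [isSub for bival].
HB.instance Definition _ := [Choice of bicommutant by <:].
HB.instance Definition _ := [SubChoice_isSubNzRing of bicommutant by <:].

Fact bicommutant_mulC : commutative (@GRing.mul bicommutant).
Proof.
move=> [a ha] [b hb]; apply/val_inj => /=.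
move/bicommP: hb; apply; apply/esym.
by move/bicommP: (ha); apply.
Qed.
HB.instance Definition _ :=
  GRing.PzRing_hasCommutativeMul.Build bicommutant bicommutant_mulC.
End Bicommutant.

(** * Shift operators and their action on vector-valued grid fields *)

Section CyclicGrid.
Variables (R : realType) (n : nat).
Notation N := n.+1.

Definition shift_mx : 'M[R]_N := \matrix_(j, i) (i == ordS j)%:R.
Definition unshift_mx : 'M[R]_N := \matrix_(j, i) (i == ord_pred j)%:R.

Lemma shift_mxM (x : 'M[R]_N) j i : (shift_mx *m x) j i = x (ordS j) i.
Proof.
rewrite mxE (bigD1 (ordS j)) //= !mxE eqxx mul1r big1 ?addr0 // => k kj.
by rewrite !mxE (negbTE kj) mul0r.
Qed.

Lemma unshift_mxM (x : 'M[R]_N) j i : (unshift_mx *m x) j i = x (ord_pred j) i.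
Proof.
rewrite mxE (bigD1 (ord_pred j)) //= !mxE eqxx mul1r big1 ?addr0 // => k kj.
by rewrite !mxE (negbTE kj) mul0r.
Qed.

Lemma shiftK : shift_mx * unshift_mx = 1.
Proof. by apply/matrixP => j i; rewrite shift_mxM !mxE ordSK eq_sym. Qed.

Lemma unshiftK : unshift_mx * shift_mx = 1.
Proof. by apply/matrixP => j i; rewrite unshift_mxM !mxE ord_predK eq_sym. Qed.

Notation cyclic_op := (bicommutant shift_mx).

Fact shift_bicomm : shift_mx \in bicomm shift_mx.
Proof. exact/bicommP. Qed.
Fact unshift_bicomm : unshift_mx \in bicomm shift_mx.
Proof.
apply/bicommP => x xs.
by rewrite -[LHS]mul1r -unshiftK -!mulrA [_ * (x * _)]mulrA -xs -!mulrA shiftK mulr1.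
Qed.
Fact scalar_bicomm (r : R) : r%:M \in bicomm shift_mx.
Proof. by apply/bicommP => x _; exact: scalar_mxC. Qed.

Definition Eop : cyclic_op := Bicommutant shift_bicomm.
Definition Fop : cyclic_op := Bicommutant unshift_bicomm.
Definition scal_op (r : R) : cyclic_op := Bicommutant (scalar_bicomm r).

Lemma EFop : Eop * Fop = 1.
Proof. by apply/val_inj; exact: shiftK. Qed.

Fact scal_op_zmod : zmod_morphism scal_op.
Proof. by move=> a b; apply/val_inj; rewrite /= raddfB. Qed.
Fact scal_op_monoid : monoid_morphism scal_op.
Proof. by split=> [|a b]; apply/val_inj => //=; exact: scalar_mxM. Qed.
HB.instance Definition _ :=
  GRing.isZmodMorphism.Build R cyclic_op scal_op scal_op_zmod.
HB.instance Definition _ :=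
  GRing.isMonoidMorphism.Build R cyclic_op scal_op scal_op_monoid.

Lemma val_scalM c (a : cyclic_op) j i : val (scal_op c * a) j i = c * val a j i.
Proof. by rewrite -[val _]/(c%:M *m val a) mul_scalar_mx mxE. Qed.

Lemma val_opsum (I : Type) (r : seq I) (P : pred I) (G : I -> cyclic_op) j i :
  val (\sum_(k <- r | P k) G k) j i = \sum_(k <- r | P k) val (G k) j i.
Proof.
apply: (big_morph (fun a : cyclic_op => val a j i)) => [a b|]; by rewrite mxE.
Qed.

Variable V : lmodType R.
Implicit Types (a b : cyclic_op) (U : 'I_N -> V).

Definition act a U : 'I_N -> V := fun j => \sum_i (val a) j i *: U i.

Lemma actD a b U j : act (a + b) U j = act a U j + act b U j.
Proof. by rewrite /act -big_split; apply: eq_bigr => i _; rewrite mxE scalerDl. Qed.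

Lemma act0 U j : act 0 U j = 0.
Proof. by rewrite /act big1 // => i _; rewrite mxE scale0r. Qed.

Lemma actN a U j : act (- a) U j = - act a U j.
Proof. by rewrite /act -sumrN; apply: eq_bigr => i _; rewrite mxE scaleNr. Qed.

Lemma actM a b U : act (a * b) U = act a (act b U).
Proof.
apply/funext => j; rewrite /act.
under [RHS]eq_bigr do rewrite scaler_sumr.
rewrite exchange_big /=; apply: eq_bigr => i _.
rewrite mxE scaler_suml; apply: eq_bigr => k _; by rewrite scalerA.
Qed.

Lemma act_sum (I : Type) (r : seq I) (P : pred I) (F : I -> cyclic_op) U j :
  act (\sum_(i <- r | P i) F i) U j = \sum_(i <- r | P i) act (F i) U j.
Proof.
exact: (big_morph (fun a => act a U j) (fun a b => actD a b U j) (act0 U j)).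
Qed.

Lemma act_scal r U j : act (scal_op r) U j = r *: U j.
Proof.
rewrite /act (bigD1 j) //= mxE eqxx mulr1n big1 ?addr0 // => i ij.
by rewrite mxE eq_sym (negbTE ij) mulr0n scale0r.
Qed.

Lemma act1 U j : act 1 U j = U j.
Proof. by rewrite -(rmorph1 scal_op) act_scal scale1r. Qed.

Lemma act_scalM r a U j : act (scal_op r * a) U j = r *: act a U j.
Proof. by rewrite actM act_scal. Qed.

Lemma act_E U j : act Eop U j = U (ordS j).
Proof.
rewrite /act (bigD1 (ordS j)) //= mxE eqxx scale1r big1 ?addr0 // => i ij.
by rewrite mxE (negbTE ij) scale0r.
Qed.

Lemma act_F U j : act Fop U j = U (ord_pred j).
Proof.
rewrite /act (bigD1 (ord_pred j)) //= mxE eqxx scale1r big1 ?addr0 // => i ij.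
by rewrite mxE (negbTE ij) scale0r.
Qed.

Lemma act_zpow i U j : act (zpow Eop Fop i) U j = U (cyc_shift i j).
Proof.
have HE k : act (Eop ^+ k) U j = U (iter k (@ordS N) j).
  elim: k j => [|k IH] j; first by rewrite act1.
  by rewrite exprS actM act_E IH iterSr.
have HF k : act (Fop ^+ k) U j = U (iter k (@ord_pred N) j).
  elim: k j {HE} => [|k IH] j; first by rewrite act1.
  by rewrite exprS actM act_F IH iterSr.
by case: i => k; [exact: HE | exact: HF].
Qed.

Definition poly_op := horner_eval (Eop - 2 + Fop) \o map_poly scal_op.
HB.instance Definition _ := GRing.RMorphism.copy poly_op
  (horner_eval (Eop - 2 + Fop) \o map_poly scal_op).

(** The window may be wider than the grid: the stencil then wraps around exactly as the powers of
    the cyclic shift do. *)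
Lemma poly_stencil_act (p : {poly R}) m U j : (size p <= m.+1)%N ->
  \sum_(k < m.*2.+1) poly_stencil p (k%:Z - m%:Z) *: U (cyc_shift (k%:Z - m%:Z) j)
  = act (poly_op p) U j.
Proof.
move=> pm; have := poly_stencil_sum scal_op EFop pm => E.
rewrite -[poly_op p]/((map_poly scal_op p).[Eop - 2 + Fop]) -E act_sum.
by apply: eq_bigr => k _; rewrite act_scalM act_zpow.
Qed.

Lemma act_linear (f : {linear V -> V}) a U j : f (act a U j) = act a (f \o U) j.
Proof. by rewrite /act linear_sum; apply: eq_bigr => i _; rewrite linearZ. Qed.

Lemma act_addU a U U' j : act a (fun k => U k + U' k) j = act a U j + act a U' j.
Proof. by rewrite /act -big_split; apply: eq_bigr => i _; rewrite scalerDr. Qed.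

Lemma act_sumU (I : Type) (r : seq I) a (U : I -> 'I_N -> V) j :
  act a (fun k => \sum_(i <- r) U i k) j = \sum_(i <- r) act a (U i) j.
Proof.
rewrite /act exchange_big /=; apply: eq_bigr => i _.
by rewrite scaler_sumr.
Qed.

Lemma act0U a j : act a (fun=> 0) j = 0.
Proof. by rewrite /act big1 // => i _; rewrite scaler0. Qed.

Definition act_series (x : fps cyclic_op) U j : nat -> V := fun m => act (x m) U j.

Lemma act_seriesD x y U j :
  act_series x U j + act_series y U j = act_series (x + y) U j.
Proof. by apply/funext => m; rewrite /act_series actD. Qed.

Lemma act_seriesN x U j : - act_series x U j = act_series (- x) U j.
Proof. by apply/funext => m; rewrite /act_series actN. Qed.

Lemma act_seriesZ c x U j :
  c *: act_series x U j = act_series (fps_cst (scal_op c) * x) U j.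
Proof. by apply/funext => m; rewrite /act_series fps_cstM act_scalM. Qed.

Lemma act_seriesX x U j :
  times_gamma (act_series x U j) = act_series (fpsX * x) U j.
Proof.
by apply/funext => -[|m]; rewrite /act_series fpsXM //= act0.
Qed.

(** Reduces an edge condition on grid fields to an identity between operator series. *)
Lemma act_series_edge (xL xR xn xp : fps cyclic_op) (t : R) U j m
    (uL := act_series xL U j) (uR := act_series xR U j)
    (un := act_series xn U j) (up := act_series xp U j) :
  xR - xL - fps_cst (scal_op 2^-1) * (fpsX * (xR - xL)) =
  fps_cst (scal_op 2^-1) * (fpsX * (xn - xp))
  + fps_cst (scal_op t) * (fpsX * (xL + xR))
  - fps_cst (scal_op t) * (fpsX * (xn + xp)) ->
  (uR - uL - 2^-1 *: times_gamma (uR - uL)) m =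
  (2^-1 *: times_gamma (un - up) + t *: times_gamma (uL + uR)
   - t *: times_gamma (un + up)) m.
Proof.
move=> h; rewrite /uL /uR /un /up.
do ! rewrite ?act_seriesN ?act_seriesD ?act_seriesX ?act_seriesZ.
by rewrite h.
Qed.

(** The condition for f = -u_x has the form of that for u with theta replaced by -theta; [c] and [d]
    are to be the shifts to the next and previous elements. *)
Lemma act_series_edgeN (xL xR c d : fps cyclic_op) (t : R) U j m
    (uL := - act_series xL U j) (uR := - act_series xR U j)
    (un := - act_series (c * xL) U j) (up := - act_series (d * xR) U j) :
  - xR - - xL - fps_cst (scal_op 2^-1) * (fpsX * (- xR - - xL)) =
  fps_cst (scal_op 2^-1) * (fpsX * (c * - xL - d * - xR))
  + fps_cst (scal_op (2^-1 * - t)) * (fpsX * (- xL + - xR))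
  - fps_cst (scal_op (2^-1 * - t)) * (fpsX * (c * - xL + d * - xR)) ->
  (uR - uL - 2^-1 *: times_gamma (uR - uL)) m =
  (2^-1 *: times_gamma (un - up) - (2^-1 * t) *: times_gamma (uL + uR)
   + (2^-1 * t) *: times_gamma (un + up)) m.
Proof.
move=> /(act_series_edge U j m); rewrite /uL /uR /un /up.
rewrite (act_seriesN xL) (act_seriesN xR) (act_seriesN (c * xL)) (act_seriesN (d * xR)).
by rewrite [2^-1 * - t]mulrN !scaleNr opprK !mulrN.
Qed.

Lemma act_series_next x U j :
  act_series x U (ordS j) = act_series (fps_cst Eop * x) U j.
Proof. by apply/funext => m; rewrite /act_series fps_cstM actM act_E. Qed.

Lemma act_series_prev x U j :
  act_series x U (ord_pred j) = act_series (fps_cst Fop * x) U j.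
Proof. by apply/funext => m; rewrite /act_series fps_cstM actM act_F. Qed.

End CyclicGrid.

(** * Edge conditions *)

Lemma dispersion_y_poly (R : realType) (theta : R) :
  dispersion theta (@adic _) (@fps_cst _ \o @polyC R) fpsX (fps_cst 'X) (y_poly theta).
Proof. by apply: disp_solP; rewrite /fpsX mul0r. Qed.

Section CoshSinh.
Variables (R : realType) (A : comNzRingType) (iota : {rmorphism R -> A}).
Notation ci := (@fps_cst A \o iota).
Let F := adic_filtered A.

Definition Ch (z : fps A) := fps_comp iota (ch R) z.
Definition Sh (z : fps A) := fps_comp iota (sh R) z.

Lemma Sh_coef0 z : Sh z 0%N = 1.
Proof. by rewrite /Sh /fps_comp big_ord1 /= /sh invr1 rmorph1 mulr1. Qed.

Lemma Ch_sqr z : adic 1 z -> Ch z ^+ 2 = 1 + z * Sh z ^+ 2.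
Proof.
move=> z1; apply: (evaluates_uniq F (iota := ci) (c := ch R ^+ 2) (z := z)).
  by apply: (evaluates_exp F) => //; exact: fps_compP.
rewrite ch_sqr; apply: (evaluatesD F); first exact: (evaluates1 F).
apply: (evaluatesM F) => //; first exact: (evaluatesX F).
by apply: (evaluates_exp F) => //; exact: fps_compP.
Qed.

Lemma dispersion_Sh theta g x z : dispersion theta (@adic A) ci g x z ->
  disp_den theta ci g x * (z * Sh z ^+ 2) = disp_num theta ci g x.
Proof.
case=> s <- [z1 zs]; congr (_ * _).
apply/esym; apply: (evaluates_uniq F zs).
apply: (evaluatesM F) => //; first exact: (evaluatesX F).
by apply: (evaluates_exp F) => //; exact: fps_compP.
Qed.

Lemma mul_fps_comp (b : fps A) c z m : adic 1 z ->
  (b * fps_comp iota c z) m = \sum_(k < m.+1) (b * (ci (c k) * z ^+ k)) m.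
Proof.
move=> z1.
have : adic m.+1 (b * (fps_comp iota c z - \sum_(k < m.+1) ci (c k) * z ^+ k)).
  by apply: (filMl F); exact: (@fps_compP _ _ iota c z z1 m.+1).
move=> /(_ m (ltnSn m)); rewrite mulrBr fpsBE => /eqP; rewrite subr_eq0 => /eqP ->.
by rewrite mulr_sumr fps_sumE.
Qed.

End CoshSinh.

Lemma big_ord_double (W : nmodType) (f : nat -> W) m :
  \sum_(l < m.*2) f l = \sum_(k < m) (f k.*2 + f k.*2.+1).
Proof.
elim: m => [|m IH]; first by rewrite !big_ord0.
by rewrite doubleS !big_ord_recr /= IH addrA.
Qed.

Section EdgeConditions.
Variables (R : realType) (A : comNzRingType) (iota : {rmorphism R -> A}).
Variables (E F : A) (theta h : R).
Hypotheses (EF : E * F = 1) (h0 : h != 0).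
Notation ci := (@fps_cst A \o iota).
Notation g := (@fpsX A).
Notation e' := (fps_cst E).
Notation f' := (fps_cst F).
Variables (T a y : fps A).
Hypotheses (yT : y = ci (h ^+ 2) * T).
Hypotheses (y1 : adic 1 y).
Hypotheses (hy : dispersion theta (@adic A) ci g (fps_cst (E - 2 + F)) y).

(** [Y] is delta^2 / 2, [D] is mu delta and [G] is gamma / 2; the relation mu^2 = 1 + delta^2 / 4
    becomes D^2 = Y^2 + 2 Y. *)
Let Y : fps A := ci 2^-1 * (e' + f') - 1.
Let D : fps A := ci 2^-1 * (e' - f').
Let G : fps A := ci 2^-1 * g.

(* The edge condition for [u] reads [h b Sh y * edge_den = a Ch y * edge_num]. *)
Definition edge_den (t : R) : fps A := 1 + G * (Y - ci t * D).
Definition edge_num (t : R) : fps A := G * (D - ci t * Y).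

Let G0 : G 0%N = 0.
Proof. by rewrite /G mulrC fpsXM. Qed.

Lemma edge_den_coef0 t : edge_den t 0%N = 1.
Proof. by rewrite /edge_den fpsDE fpsM_coef0 G0 mul0r addr0. Qed.

(** The amplitude b solved from the edge condition for u; [edge_den] and [Sh] can be inverted since
    their constant terms are 1. *)
Definition odd_ampl : fps A :=
  ci h^-1 * a * Ch iota y * edge_num theta
  * fps_comp iota (inv1p_coef R) (edge_den theta - 1)
  * fps_comp iota (inv1p_coef R) (Sh iota y - 1).

Lemma odd_ampl_coef0 : odd_ampl 0%N = 0.
Proof.
by rewrite /odd_ampl !fpsM_coef0 [edge_num _ _]fpsM_coef0 G0 !(mul0r, mulr0).
Qed.

Let hK : ci h * ci h^-1 = 1.
Proof. by rewrite -rmorphM mulfV // rmorph1. Qed.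
Let twoK : 2 * ci 2^-1 = 1.
Proof. by rewrite -(rmorph_nat ci) -rmorphM mulfV ?pnatr_eq0 // rmorph1. Qed.
Let EF' : e' * f' = 1.
Proof. by rewrite -rmorphM EF rmorph1. Qed.

Lemma edge_u_odd :
  ci h * odd_ampl * Sh iota y * edge_den theta = a * Ch iota y * edge_num theta.
Proof.
have D1 := fps_unit iota (edge_den_coef0 theta).
have S1 := fps_unit iota (Sh_coef0 iota y).
rewrite /odd_ampl; move: D1 S1 hK.
move: (fps_comp _ _ (edge_den theta - 1)) (fps_comp _ _ (Sh iota y - 1)) => d s D1 S1 hK'.
transitivity ((ci h * ci h^-1) * (edge_den theta * d) * (Sh iota y * s)
   * (a * Ch iota y * edge_num theta)); first by ring.
by rewrite hK' D1 S1 !mul1r.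
Qed.

Let D_sqr : D ^+ 2 = Y ^+ 2 + 2 * Y.
Proof.
rewrite /D /Y; move: twoK EF'; move: (ci 2^-1) => c c2 uv.
transitivity ((c * (e' + f')) ^+ 2 - (2 * c) ^+ 2 * (e' * f')); first by ring.
by rewrite c2 uv; ring.
Qed.

Let two_Y : fps_cst (E - 2 + F) = 2 * Y.
Proof.
rewrite /Y mulrBr mulrA twoK rmorphD rmorphB rmorph_nat /=; ring.
Qed.

Let disp_denE : disp_den theta ci g (fps_cst (E - 2 + F)) =
  1 + 2 * G * Y - 2 * (ci theta ^+ 2 + 1) * G ^+ 2 * Y.
Proof.
rewrite two_Y /disp_den /G /=.
have -> : (theta ^+ 2 + 1) / 4 = (theta ^+ 2 + 1) * 2^-1 ^+ 2 by field.
rewrite -[fps_cst (iota (_ * _))]/(ci ((theta ^+ 2 + 1) * 2^-1 ^+ 2)).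
have -> : ci ((theta ^+ 2 + 1) * 2^-1 ^+ 2) = (ci theta ^+ 2 + 1) * ci 2^-1 ^+ 2 :> fps A.
  by rewrite rmorphM rmorphD !rmorphXn rmorph1.
by rewrite /=; ring.
Qed.

Let disp_numE : disp_num theta ci g (fps_cst (E - 2 + F)) =
  G ^+ 2 * Y * (2 + (1 - ci theta ^+ 2) * Y).
Proof.
rewrite two_Y /disp_num /G /=.
have -> : (1 - theta ^+ 2) / 4 = (1 - theta ^+ 2) * 2^-1 ^+ 2 by field.
have -> : 4^-1 = 2^-1 ^+ 2 :> R by field.
have -> : fps_cst (iota ((1 - theta ^+ 2) * 2^-1 ^+ 2)) =
    (1 - ci theta ^+ 2) * ci 2^-1 ^+ 2 :> fps A.
  by rewrite -[LHS]/(ci ((1 - theta ^+ 2) * 2^-1 ^+ 2)) rmorphM rmorphB !rmorphXn rmorph1.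
have -> : fps_cst (iota (2^-1 ^+ 2)) = ci 2^-1 ^+ 2 :> fps A.
  by rewrite -[LHS]/(ci (2^-1 ^+ 2)) rmorphXn.
rewrite /=.
move: twoK => /=; move: (fps_cst (iota 2^-1)) (fps_cst (iota theta)) => c t c2.
transitivity (c ^+ 2 * g ^+ 2 * Y * (2 + (2 * c) ^+ 2 * (1 - t ^+ 2) * Y)); first by ring.
by rewrite c2; ring.
Qed.

(** The result of eliminating b from the two edge conditions. The product of the two [edge_num] is
    [disp_num], that of the two [edge_den] is [disp_den + disp_num]; with Ch^2 = 1 + y Sh^2 the
    claim is the dispersion relation. *)
Lemma edge_key : y * Sh iota y ^+ 2 * (edge_den theta * edge_den (- theta))
  = Ch iota y ^+ 2 * (edge_num theta * edge_num (- theta)).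
Proof.
have key := dispersion_Sh hy; rewrite disp_denE disp_numE in key.
rewrite Ch_sqr //; move: key; move: (y * Sh iota y ^+ 2) => s key.
have N2 : edge_num theta * edge_num (- theta) =
    G ^+ 2 * Y * (2 + (1 - ci theta ^+ 2) * Y).
  rewrite /edge_num rmorphN.
  transitivity (G ^+ 2 * (D ^+ 2 - ci theta ^+ 2 * Y ^+ 2)); first by ring.
  by rewrite D_sqr; ring.
have D2 : edge_den theta * edge_den (- theta) =
    (1 + 2 * G * Y - 2 * (ci theta ^+ 2 + 1) * G ^+ 2 * Y)
    + G ^+ 2 * Y * (2 + (1 - ci theta ^+ 2) * Y).
  rewrite /edge_den rmorphN.
  transitivity ((1 + G * Y) ^+ 2 - G ^+ 2 * ci theta ^+ 2 * D ^+ 2); first by ring.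
  by rewrite D_sqr; ring.
by rewrite D2 N2 mulrDr [s * (_ - _)]mulrC key; ring.
Qed.

Lemma edge_f_odd : T * ci h * a * Sh iota y * edge_den (- theta)
  = odd_ampl * Ch iota y * edge_num (- theta).
Proof.
have D1 := fps_unit iota (edge_den_coef0 theta).
have S1 := fps_unit iota (Sh_coef0 iota y).
have key := edge_key.
rewrite /odd_ampl; move: D1 S1 hK.
move: (fps_comp _ _ (edge_den theta - 1)) (fps_comp _ _ (Sh iota y - 1)) => d s D1 S1 hK'.
transitivity ((ci h * ci h^-1) * (edge_den theta * d) * (Sh iota y * s) *
  (T * ci h * a * Sh iota y * edge_den (- theta))).
  by rewrite hK' D1 S1 !mul1r.
transitivity (y * Sh iota y ^+ 2 * (edge_den theta * edge_den (- theta))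
   * (ci h^-1 * a * d * s)).
  by rewrite {3}yT rmorphXn; ring.
by rewrite key; ring.
Qed.

(** [P] and [B] are the even and odd parts in xi of the edge values; in these terms the edge
    condition is twice the hypothesis. *)
Lemma edge_condition t (P B uL uR : fps A) : B * edge_den t = P * edge_num t ->
  uL = P - B -> uR = P + B ->
  uR - uL - ci 2^-1 * (g * (uR - uL)) =
  ci 2^-1 * (g * (e' * uL - f' * uR))
  + ci (2^-1 * t) * (g * (uL + uR))
  - ci (2^-1 * t) * (g * (e' * uL + f' * uR)).
Proof.
move=> + -> ->; rewrite /edge_den /edge_num /G /Y /D [ci (_ * t)]rmorphM /=.
move: twoK => /=.
move: (fps_cst (iota 2^-1)) (fps_cst (iota t)) e' f' => c u e f c2 H.
apply/eqP; rewrite -subr_eq0; apply/eqP.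
move/eqP: H; rewrite -subr_eq0 => /eqP; set W := _ - _ => W0.
(* The generalised [c] is known to be 1/2 only through 2 c = 1, hence the correction by a multiple
   of 1 - 2 c. *)
transitivity (2 * W + (1 - 2 * c) * (c * g * (e + f) * B - c * u * g * (e - f) * B
   - c * g * (e - f) * P + u * c * g * (e + f) * P)); first by rewrite /W; ring.
by rewrite W0 c2; ring.
Qed.

End EdgeConditions.

(** * Subgrid fields as Taylor series in xi *)

Section TaylorField.
Variables (R : realType) (A : comNzRingType) (iota : {rmorphism R -> A}).
Variables (T a b : fps A).
Hypothesis T1 : adic 1 T.
Notation ci := (@fps_cst A \o iota).
Let FA := adic_filtered A.

(* The coefficients of [cosh (sqrt T xi) a + sinh (sqrt T xi) / sqrt T b] in
   powers of [xi], up to the factorials. *)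
Definition taylor k : fps A := T ^+ k./2 * (if odd k then b else a).

Lemma taylor_double k l : taylor (k + l.*2) = T ^+ l * taylor k.
Proof.
rewrite /taylor oddD odd_double addbF mulrA -exprD; congr (_ ^+ _ * _); lia.
Qed.

(** As T = O(gamma), at order m the field is a polynomial in xi of degree at most 2 m + 1. *)
Lemma taylor_eq0 k m : (m.+1.*2 <= k)%N -> taylor k m = 0.
Proof.
move=> mk; have h1 := @adic_exp _ _ k./2 T1.
by apply: (filMr FA _ h1); lia.
Qed.

Definition y_at (xi : R) : fps A := ci (xi ^+ 2) * T.

(** Closed form of the k-th derivative in xi of the field: the even powers of the Taylor sum give
    [Ch], the odd ones xi [Sh]. *)
Definition field_op k xi : fps A :=
  taylor k * Ch iota (y_at xi) + ci xi * taylor k.+1 * Sh iota (y_at xi).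

Lemma adic_y_at xi : adic 1 (y_at xi).
Proof. exact: (filMl FA). Qed.

Lemma y_at_exp xi r : y_at xi ^+ r = ci (xi ^+ r.*2) * T ^+ r.
Proof. by rewrite /y_at exprMn -[ci _ ^+ r]rmorphXn -exprM mul2n. Qed.

Lemma field_op_taylor k xi m :
  \sum_(l < m.+1.*2) iota (xi ^+ l / l`!%:R) * taylor (k + l) m = field_op k xi m.
Proof.
rewrite (@big_ord_double _ (fun l => iota (xi ^+ l / l`!%:R) * taylor (k + l) m)).
rewrite big_split /field_op fpsDE; congr (_ + _).
  rewrite /Ch mul_fps_comp; last exact: adic_y_at.
  apply: eq_bigr => r _; rewrite taylor_double y_at_exp -fps_cstM /ch.
  have -> : fps_cst (iota (xi ^+ r.*2 / (r.*2)`!%:R)) =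
      ci (xi ^+ r.*2) * ci (r.*2)`!%:R^-1 by rewrite -rmorphM.
  apply: (congr1 (fun f : fps A => f m)); rewrite /=; ring.
rewrite /Sh mul_fps_comp; last exact: adic_y_at.
apply: eq_bigr => r _; rewrite -addSnnS taylor_double y_at_exp -fps_cstM /sh.
have -> : fps_cst (iota (xi ^+ r.*2.+1 / (r.*2.+1)`!%:R)) =
    ci xi * ci (xi ^+ r.*2) * ci (r.*2.+1)`!%:R^-1 by rewrite -!rmorphM -exprS.
apply: (congr1 (fun f : fps A => f m)); rewrite /=; ring.
Qed.

Lemma field_op_even k xi : field_op k.*2 xi = T ^+ k * field_op 0 xi.
Proof.
by rewrite /field_op -[k.*2]add0n -addSn !taylor_double; ring.
Qed.

(** Averaging over [-h, h] kills the odd powers, and the mean of xi^(2r) / (2r)! is h^(2r) /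
    (2r+1)!, where 1 / (2r+1)! is a coefficient of [sh]. *)
Lemma mean_taylor (h : R) m : h != 0 ->
  \sum_(l < m.+1.*2) iota ((2 * h)^-1 * ((h ^+ l.+1 - (- h) ^+ l.+1) / l.+1%:R)
     / l`!%:R) * taylor l m = (a * Sh iota (y_at h)) m.
Proof.
move=> h0; pose f l := iota ((2 * h)^-1 * ((h ^+ l.+1 - (- h) ^+ l.+1) / l.+1%:R)
     / l`!%:R) * taylor l m.
rewrite (@big_ord_double _ f) /Sh mul_fps_comp; last exact: adic_y_at.
apply: eq_bigr => r _; rewrite /f y_at_exp.
rewrite [(- h) ^+ r.*2.+1]exprNn [(- h) ^+ r.*2.+2]exprNn.
have -> : (-1) ^+ r.*2.+1 = -1 :> R by rewrite -signr_odd /= odd_double expr1.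
have -> : (-1) ^+ r.*2.+2 = 1 :> R by rewrite -signr_odd /= odd_double.
rewrite mul1r subrr mul0r mulr0 mul0r rmorph0 mul0r addr0.
have -> : taylor r.*2 = T ^+ r * a by rewrite /taylor odd_double doubleK.
rewrite -fps_cstM; apply: (congr1 (fun f : fps A => f m)).
have -> : (2 * h)^-1 * ((h ^+ r.*2.+1 - -1 * h ^+ r.*2.+1) / r.*2.+1%:R) / (r.*2)`!%:R
   = h ^+ r.*2 * sh R r.
  rewrite /sh factS natrM exprS.
  have f0 z : z`!%:R != 0 :> R by rewrite pnatr_eq0 -lt0n fact_gt0.
  have := f0 r.*2; have : r.*2.+1%:R != 0 :> R by rewrite pnatr_eq0.
  move: (_`!%:R) (r.*2.+1%:R) => p q q0 p0.
  by field; rewrite h0 p0 q0.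
have -> : fps_cst (iota (h ^+ r.*2 * sh R r)) = ci (h ^+ r.*2) * ci (sh R r).
  by rewrite -rmorphM.
rewrite /=; ring.
Qed.

End TaylorField.

Section EdgeFields.
Variables (R : realType) (A : comNzRingType) (iota : {rmorphism R -> A}).
Variables (E F : A) (theta h : R).
Hypotheses (EF : E * F = 1) (h0 : h != 0).
Variables (T a : fps A).
Hypothesis T1 : adic 1 T.
Notation ci := (@fps_cst A \o iota).
Notation y := (y_at iota T h).
Hypothesis hy : dispersion theta (@adic A) ci fpsX (fps_cst (E - 2 + F)) y.
Notation b := (odd_ampl iota E F theta h a y).
Notation fop := (field_op iota T a b).

Lemma field_op0E xi : fop 0 xi =
  a * Ch iota (y_at iota T xi) + ci xi * b * Sh iota (y_at iota T xi).
Proof. by rewrite /field_op /taylor /= !mul1r. Qed.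

Lemma field_op1E xi : fop 1 xi =
  b * Ch iota (y_at iota T xi) + T * ci xi * a * Sh iota (y_at iota T xi).
Proof.
rewrite /field_op /taylor /= mul1r expr1.
by move: (odd_ampl _ _ _ _ _ _ _) => b'; ring.
Qed.

Lemma y_atN xi : y_at iota T (- xi) = y_at iota T xi.
Proof. by rewrite /y_at sqrrN. Qed.

Lemma edge_u_field (xL := fop 0 (- h)) (xR := fop 0 h) :
  xR - xL - ci 2^-1 * (fpsX * (xR - xL)) =
  ci 2^-1 * (fpsX * (fps_cst E * xL - fps_cst F * xR))
  + ci (2^-1 * theta) * (fpsX * (xL + xR))
  - ci (2^-1 * theta) * (fpsX * (fps_cst E * xL + fps_cst F * xR)).
Proof.
apply: (edge_condition (edge_u_odd iota E F theta h0 a y)).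
  by rewrite /xL field_op0E y_atN rmorphN !mulNr.
by rewrite /xR field_op0E.
Qed.

Lemma edge_f_field (xL := - fop 1 (- h)) (xR := - fop 1 h) :
  xR - xL - ci 2^-1 * (fpsX * (xR - xL)) =
  ci 2^-1 * (fpsX * (fps_cst E * xL - fps_cst F * xR))
  + ci (2^-1 * - theta) * (fpsX * (xL + xR))
  - ci (2^-1 * - theta) * (fpsX * (fps_cst E * xL + fps_cst F * xR)).
Proof.
have e := edge_f_odd EF h0 a (erefl _) (adic_y_at iota T1 h) hy.
(* Differentiation exchanges parities: at the edge, b Ch is the even part of u_x and T h a Sh its
   odd part. *)
apply: (@edge_condition _ _ _ _ _ _ (- (b * Ch iota y))
  (- (T * ci h * a * Sh iota y))); first by rewrite [LHS]mulNr [RHS]mulNr e.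
  by rewrite /xL field_op1E y_atN rmorphN mulrN !mulNr opprD.
by rewrite /xR field_op1E opprD.
Qed.

End EdgeFields.

(** * Existence of the subgrid fields *)

Section Existence.
Variables (R : realType) (n : nat) (V : lmodType R) (K : nat -> {linear V -> V}).
Variables (H theta : R) (amp : amplitude).
Hypothesis H0 : H != 0.
Notation N := n.+1.
Notation A := (bicommutant (shift_mx R n)).
Notation ci := (@fps_cst A \o @scal_op R n).
Notation E := (Eop R n).
Notation F := (Fop R n).
Notation h := (H / 2).
Let FA := adic_filtered A.

Definition T_op : fps A := fps_map (@poly_op R n) (T_poly H theta).

Lemma poly_op_cst c : @poly_op R n c%:P = scal_op n c.
Proof. by rewrite /poly_op /= map_polyC /= /horner_eval hornerC. Qed.

Lemma T_op_exp k m : (T_op ^+ k) m = poly_op n ((T_poly H theta ^+ k) m).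
Proof. by rewrite /T_op -rmorphXn. Qed.

Lemma adic_T_op : adic 1 T_op.
Proof. exact/adic_map/adic_T_poly. Qed.

Notation y_op := (y_at (@scal_op R n) T_op h).

Lemma y_opE : fps_map (@poly_op R n) (y_poly theta) = y_op.
Proof.
have TE : T_op = ci (4 / H ^+ 2) * fps_map (@poly_op R n) (y_poly theta).
  transitivity (fps_map (@poly_op R n) (fps_cst (4 / H ^+ 2)%:P)
     * fps_map (@poly_op R n) (y_poly theta)); first exact: rmorphM.
  by rewrite fps_map_cst; congr (fps_cst _ * _); exact: poly_op_cst.
have E1 : h ^+ 2 * (4 / H ^+ 2) = 1 by field.
by rewrite /y_at TE mulrA -rmorphM E1 rmorph1 mul1r.
Qed.

Lemma dispersion_y_op : dispersion theta (@adic A) ci fpsX (fps_cst (E - 2 + F)) y_op.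
Proof.
have EX : @poly_op R n 'X = E - 2 + F.
  by rewrite /poly_op /= map_polyX /= /horner_eval hornerX.
rewrite -y_opE -EX -[fps_cst (poly_op n _)](fps_map_cst (@poly_op R n)).
rewrite -(fps_mapX (@poly_op R n)).
apply: (dispersion_morph (phi := fps_map (@poly_op R n)) _ _ (dispersion_y_poly theta)).
  by move=> k z zk; exact: adic_map.
by move=> c; rewrite /= fps_map_cst; congr (fps_cst _); exact: poly_op_cst.
Qed.

(** The field has midpoint value a and mean a Sh(y), by [mean_taylor]; this choice makes the
    prescribed amplitude the identity. *)
Definition even_ampl : fps A :=
  match amp with
  | Midpoint => 1
  | Average => fps_comp (@scal_op R n) (inv1p_coef R) (Sh (@scal_op R n) y_op - 1)
  end.
Notation a := even_ampl.

Lemma even_ampl_coef0 : a 0%N = 1.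
Proof.
rewrite /a; case: amp => //.
by rewrite /fps_comp big_ord1 /= /inv1p_coef expr0 rmorph1 mulr1.
Qed.

Notation b := (odd_ampl (@scal_op R n) E F theta h even_ampl y_op).

Notation tay := (taylor T_op even_ampl b).

Definition subgrid m : 'M[{poly R}]_N :=
  \matrix_(j, i) \poly_(k < m.+1.*2) (val (scal_op n (k`!%:R)^-1 * tay k m)) j i.

Lemma coef_subgrid m j i k :
  (subgrid m j i)`_k = (val (scal_op n (k`!%:R)^-1 * tay k m)) j i.
Proof.
rewrite mxE coef_poly; case: ltnP => // mk.
by rewrite (taylor_eq0 _ _ adic_T_op) // mulr0 mxE.
Qed.

Notation fop := (field_op (@scal_op R n) T_op even_ampl b).

Lemma horner_deriv_subgrid k m j i xi :
  ((subgrid m j i)^`(k)).[xi] =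
  \sum_(l < m.+1.*2) (val (scal_op n (xi ^+ l / l`!%:R) * tay (k + l) m)) j i.
Proof.
rewrite (horner_coef_wide _ (n := m.+1.*2)); last first.
  apply/leq_sizeP => l ml; rewrite coef_derivn coef_subgrid.
  rewrite (taylor_eq0 _ _ adic_T_op) ?mulr0 ?mxE ?mul0rn //; lia.
apply: eq_bigr => l _; rewrite coef_derivn coef_subgrid.
rewrite !val_scalM -[_ *+ ((k + l) ^_ k)]mulr_natr.
have := ffact_fact (leq_addr l k); rewrite addKn => /(congr1 (fun z => z%:R : R)).
have f0 z : z`!%:R != 0 :> R by rewrite pnatr_eq0 -lt0n fact_gt0.
rewrite natrM; have := f0 (k + l)%N; have := f0 l.
move: (l`!%:R) ((k + l)`!%:R) (((k + l) ^_ k)%:R) => p q s p0 q0 E1.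
rewrite -E1 in q0 *; move: q0; rewrite mulf_eq0 negb_or => /andP[s0 _].
by field; rewrite p0 s0.
Qed.

Lemma fieldE k U j xi m : field (V := V) subgrid k U j xi m = act (fop k xi m) U j.
Proof.
rewrite -(field_op_taylor _ _ _ adic_T_op) act_sum /field /act exchange_big /=.
apply: eq_bigr => i _; rewrite horner_deriv_subgrid -scaler_suml.
by [].
Qed.

Definition G_op m (U : 'I_N -> V) : 'I_N -> V :=
  fun j => apply_stencil (holistic_stencil K H theta m) U j.

Lemma G_opE m B U j : (m < B)%N -> G_op m U j =
  (if m == 0%N then K 0%N (U j) else 0)
  + \sum_(1 <= k < B) K k (act ((T_op ^+ k) m) U j).
Proof.
move=> mB; rewrite /G_op /apply_stencil (@fsum_window _ _ m); last first.
  by move=> i mi; rewrite holistic_stencil_eq0.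
rewrite big_split exchange_big /=; congr (_ + _).
  case: eqP => [->|_] /=; last by rewrite big1.
  by rewrite big_ord1.
rewrite (@big_cat_nat _ _ _ m.+1 1 B) //= [X in _ = _ + X]big_nat_cond.
rewrite [X in _ = _ + X]big1 ?addr0; last first.
  move=> k /andP[/andP[mk _] _].
  by rewrite (adic_exp (n := k) adic_T_op) // act0 linear0.
apply: eq_bigr => k _; rewrite T_op_exp -(@poly_stencil_act _ _ _ _ m) ?size_T_poly //.
by rewrite linear_sum; apply: eq_bigr => i _; rewrite linearZ.
Qed.

Lemma field_seriesE k U i xi :
  field (V := V) subgrid k U i xi = act_series (fop k xi) U i.
Proof. by apply/funext => m; exact: fieldE. Qed.

Lemma sum_nat_trunc (W : nmodType) (f : nat -> W) p q : (p <= q)%N ->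
  (forall k, (p <= k)%N -> f k = 0) -> (0 < p)%N ->
  \sum_(1 <= k < q) f k = \sum_(1 <= k < p) f k.
Proof.
move=> pq f0 p0; rewrite (@big_cat_nat _ _ _ p 1 q) //=.
rewrite [X in _ + X]big_nat_cond [X in _ + X]big1 ?addr0 //.
by move=> k /andP[/andP[pk _] _]; rewrite f0.
Qed.

(** The convolution in [field_dt] multiplies the field by each T^k, which amounts to 2k derivatives
    in xi; K_k passes through the operators because their entries are real. *)
Lemma subgrid_pde U j xi m :
  field_dt subgrid G_op U j xi m =
  K 0%N (field subgrid 0 U j xi m)
  + \sum_(1 <= k < (\max_(i < N) size (subgrid m j i)).+1)
      K k (field subgrid k.*2 U j xi m).
Proof.
(* Beyond [m] the powers of T vanish at the orders involved, and beyond [M] so do the derivatives;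
   one bound therefore serves both sums. *)
set M := \max_(i < N) _; pose B := (maxn m M).+1.
rewrite -(@sum_nat_trunc _ (fun k => K k (field subgrid k.*2 U j xi m)) _ B) //; last 2 first.
- by rewrite ltnS leq_maxr.
- move=> k Mk; rewrite (_ : field _ _ _ _ _ _ = 0) ?linear0 //.
  rewrite /field big1 // => i _; rewrite derivn_poly0 ?horner0 ?scale0r //.
  have : (size (subgrid m j i) <= M)%N by apply: (leq_bigmax i).
  by move: Mk; lia.
rewrite /field_dt.
have G_at r : (r <= m)%N -> field subgrid 0 (G_op (m - r) U) j xi r =
    (if r == m then K 0%N (act (fop 0 xi r) U j) else 0) +
    \sum_(1 <= k < B) K k (act (fop 0 xi r * (T_op ^+ k) (m - r)%N) U j).
  move=> rm; rewrite fieldE.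
  have -> : G_op (m - r) U = fun i => (if (m - r == 0)%N then K 0%N (U i) else 0) +
      \sum_(1 <= k < B) K k (act ((T_op ^+ k) (m - r)%N) U i).
    by apply/funext => i; rewrite (@G_opE _ B) //; rewrite /B; lia.
  rewrite act_addU act_sumU; congr (_ + _).
    rewrite subn_eq0 -[r == m]/(r == m) eqn_leq rm /=; case: ifP => _.
      by rewrite (act_linear (K 0%N)).
    exact: act0U.
  apply: eq_bigr => k _; rewrite actM.
  by rewrite (act_linear (K k)).
under eq_bigr do rewrite G_at -1?ltnS //.
rewrite big_split exchange_big /=; congr (_ + _).
  rewrite big_ord_recr /= eqxx big1 ?add0r ?fieldE // => i _.
  by rewrite ltn_eqF.
apply: eq_bigr => k _; rewrite -linear_sum -act_sum fieldE field_op_even.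
by rewrite [T_op ^+ k * _]mulrC fpsME.
Qed.

Lemma subgrid_amplitude m j i :
  amplitude_of amp H (subgrid m j i) = ((m == 0%N) && (i == j))%:R.
Proof.
have one_at : (val ((1 : fps A) m)) j i = ((m == 0%N) && (i == j))%:R.
  by rewrite fps1E; case: eqP => _; rewrite /= mxE // eq_sym.
have aE : even_ampl = match amp with Midpoint => 1
  | Average => fps_comp (@scal_op R n) (inv1p_coef R) (Sh (@scal_op R n) y_op - 1) end by [].
rewrite -one_at; case: amp aE => aE /=.
  rewrite horner_coef0 coef_subgrid fact0 invr1 rmorph1 mul1r.
  by rewrite /taylor /= mul1r aE.
have S1 := fps_unit (@scal_op R n) (Sh_coef0 (@scal_op R n) y_op).
have -> : (1 : fps A) = even_ampl * Sh (@scal_op R n) y_op by rewrite aE mulrC S1.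
have h0 : h != 0 by rewrite mulf_neq0 ?invr_neq0 // pnatr_eq0.
rewrite -(mean_taylor _ even_ampl b adic_T_op m h0) val_opsum.
have s : (size (subgrid m j i) <= m.+1.*2)%N by rewrite mxE size_poly.
pose f k := (subgrid m j i)`_k * (h ^+ k.+1 - (- h) ^+ k.+1) / k.+1%:R.
have fE : \sum_(k < size (subgrid m j i)) f k = \sum_(k < m.+1.*2) f k.
  rewrite (big_ord_widen _ f s) big_mkcond; apply: eq_bigr => k _.
  by case: ltnP => // sk; rewrite /f nth_default // !mul0r.
rewrite [X in _ * X]fE mulr_sumr; apply: eq_bigr => k _.
have -> : 2 * h = H by rewrite mulrC divfK // pnatr_eq0.
rewrite /f coef_subgrid !val_scalM.
move: (fun_of_matrix _ j i) (h ^+ k.+1 - _) (k.+1%:R^-1) (k`!%:R^-1) => p q t u.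
by field.
Qed.

Lemma field_series_next k U i xi :
  field (V := V) subgrid k U (ordS i) xi = act_series (fps_cst E * fop k xi) U i.
Proof.
by apply: (etrans (field_seriesE _ _ _ _)); exact: act_series_next.
Qed.

Lemma field_series_prev k U i xi :
  field (V := V) subgrid k U (ord_pred i) xi = act_series (fps_cst F * fop k xi) U i.
Proof.
by apply: (etrans (field_seriesE _ _ _ _)); exact: act_series_prev.
Qed.

Lemma holistic_exists : holistic K H theta amp subgrid G_op.
Proof.
have h0 : h != 0 by rewrite mulf_neq0 ?invr_neq0 // pnatr_eq0.
split.
(* At gamma = 0 both T and b vanish and a = 1, so only the constant coefficient survives. *)
- move=> j i; apply/polyP => k; rewrite coef_subgrid coefC.
  case: k => [|[|k]] /=.
  + rewrite /taylor /= mul1r even_ampl_coef0 mulr1 fact0 invr1 rmorph1.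
    by rewrite mxE eq_sym.
  + by rewrite /taylor /= mul1r odd_ampl_coef0 mulr0 mxE.
  + by rewrite (taylor_eq0 _ _ adic_T_op) // mulr0 mxE.
- exact: subgrid_amplitude.
- by move=> U j xi m _; exact: subgrid_pde.
- move=> U j m /=; rewrite !field_series_next !field_series_prev !field_seriesE.
  exact: (act_series_edge U j m (edge_u_field (@scal_op R n) E F theta h0 T_op even_ampl)).
- move=> U j m /=; rewrite !field_series_next !field_series_prev !field_seriesE.
  exact: (act_series_edgeN U j m
    (edge_f_field (EFop R n) h0 even_ampl adic_T_op dispersion_y_op)).
Qed.

End Existence.

(** * Uniqueness *)

Section Uniqueness.
Variables (R : realType) (V : lmodType R).

(* [f x - 2^n f (x / 2)] has no term of degree [n]. *)
Lemma vector_poly_eq0 (r : R) n (c : nat -> V) : 0 < r ->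
  (forall x, `|x| < r -> \sum_(e < n) x ^+ e *: c e = 0) ->
  forall e, (e < n)%N -> c e = 0.
Proof.
move=> r0; elim: n c => // n IH c hc.
have low e : (e < n)%N -> c e = 0.
  move=> en; have : (1 - 2 ^+ (n - e)) *: c e = 0.
    apply: (IH (fun e => (1 - 2 ^+ (n - e)) *: c e)) => // x xr.
    have x2r : `|x / 2| < r.
      rewrite normrM (@ger0_norm _ 2^-1) ?invr_ge0 //.
      by apply: le_lt_trans xr; rewrite ler_piMr // invf_le1 // ler1n.
    have E : \sum_(e < n.+1) ((1 - 2 ^+ (n - e)) * x ^+ e) *: c e = 0.
      have := hc _ x2r => /(congr1 (fun z => 2 ^+ n *: z)).
      rewrite scaler0 scaler_sumr => H2.
      transitivity (\sum_(e < n.+1) x ^+ e *: c e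
         - \sum_(e < n.+1) 2 ^+ n *: ((x / 2) ^+ e *: c e)); last first.
        by rewrite hc // H2 subrr.
      rewrite -sumrB; apply: eq_bigr => i _.
      rewrite scalerA -scalerBl; congr (_ *: _).
      rewrite expr_div_n mulrBl mul1r; congr (_ - _).
      have i_n : (i <= n)%N by rewrite -ltnS.
      have -> : 2 ^+ n = 2 ^+ (n - i) * 2 ^+ i :> R by rewrite -exprD subnK.
      rewrite -mulrA [2 ^+ i * _]mulrC -mulrA mulVf ?mulr1 // expf_neq0 ?pnatr_eq0 //.
    move: E; rewrite big_ord_recr /= subnn expr0 subrr mul0r scale0r addr0 => E.
    by rewrite -[RHS]E; apply: eq_bigr => i _; rewrite scalerA mulrC.
  move/eqP; rewrite scaler_eq0 => /orP[|/eqP //].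
  rewrite subr_eq0 eq_sym => /eqP h; exfalso; move: h.
  apply/eqP; rewrite gt_eqF // exprn_egt1 // ?ltr1n //; lia.
move=> e; rewrite ltnS leq_eqVlt => /predU1P[->|]; last exact: low.
(* With the lower coefficients gone, the value at the nonzero point r / 2 isolates the top one. *)
have h2 : `|r / 2| < r by rewrite ger0_norm ?divr_ge0 1?ltW// ltr_pdivrMr // ltr_pMr // ltr1n.
have := hc _ h2; rewrite big_ord_recr /= big1 ?add0r => [/eqP|i _]; last first.
  by rewrite low ?scaler0.
by rewrite scaler_eq0 expf_eq0 mulf_eq0 invr_eq0 pnatr_eq0 gt_eqF // andbF => /eqP.
Qed.

Lemma size_derivn_leq k (p : {poly R}) : (size p^`(k) <= size p)%N.
Proof.
apply/leq_sizeP => e pe; rewrite coef_derivn nth_default ?mul0rn //.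
exact: leq_trans (leq_addl _ _).
Qed.

Variables (N : nat) (K : nat -> {linear V -> V}) (H theta : R) (amp : amplitude).
Hypothesis H0 : 0 < H.
Hypothesis K1_inj : injective (K 1%N).
Implicit Types (v w : nat -> 'M[{poly R}]_N) (G : nat -> ('I_N -> V) -> 'I_N -> V) (U : 'I_N -> V).

Lemma amplitude_wide a (P : {poly R}) n : (size P <= n)%N ->
  amplitude_of a H P = match a with
    | Midpoint => P.[0]
    | Average => H^-1 * \sum_(k < n)
        P`_k * ((H / 2) ^+ k.+1 - (- (H / 2)) ^+ k.+1) / k.+1%:R
    end.
Proof.
case: a => //= s; congr (_ * _).
pose f k := P`_k * ((H / 2) ^+ k.+1 - (- (H / 2)) ^+ k.+1) / k.+1%:R.
rewrite -[LHS]/(\sum_(k < size P) f k) (big_ord_widen _ f s) big_mkcond.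
apply: eq_bigr => k _; case: ltnP => // sk.
by rewrite nth_default // !mul0r.
Qed.

Lemma amplitudeB a (P Q : {poly R}) :
  amplitude_of a H (P - Q) = amplitude_of a H P - amplitude_of a H Q.
Proof.
pose n := maxn (size P) (size Q).
have sB : (size (P - Q)%R <= n)%N.
  by rewrite (leq_trans (size_polyD _ _)) // size_polyN.
rewrite !(@amplitude_wide a _ n) ?leq_maxl ?leq_maxr //.
case: a; first by rewrite hornerD hornerN.
rewrite -mulrBr -sumrB; congr (_ * _); apply: eq_bigr => k _.
by rewrite coefB !mulrBl.
Qed.

Lemma amplitudeC a c : amplitude_of a H c%:P = c.
Proof.
rewrite (@amplitude_wide a _ 1) ?size_polyC ?leq_b1 //.
case: a; first by rewrite hornerC.
rewrite big_ord1 coefC /= !expr1 divr1 opprK -splitr mulrCA mulVf ?mulr1 //.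
by rewrite gt_eqF.
Qed.

Lemma eq_field v w n U j xi m : v m = w m -> field v n U j xi m = field w n U j xi m :> V.
Proof. by rewrite /field => ->. Qed.

Lemma field_base v G n U j xi : holistic K H theta amp v G ->
  field v n U j xi 0 = if n == 0%N then U j else 0.
Proof.
case=> base _ _ _ _; rewrite /field (bigD1 j) //= big1 ?addr0 => [|i ij].
  by rewrite base eqxx derivnC; case: n => [|n] /=; rewrite ?hornerC ?horner0 ?scale1r ?scale0r.
by rewrite base (negbTE ij) derivnC if_same horner0 scale0r.
Qed.

Lemma holistic_G0 v G U j : holistic K H theta amp v G -> G 0%N U j = K 0%N (U j).
Proof.
move=> hvG; have h0 : `|0 : R| < H / 2 by rewrite normr0 divr_gt0.
have := holistic_pde hvG U j 0 h0.
rewrite /field_dt big_ord1 subn0 !(field_base _ _ _ _ hvG) /= => ->.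
rewrite big_nat_cond big1 ?addr0 // => k /andP[/andP[k0 _] _].
by rewrite (field_base _ _ _ _ hvG) double_eq0 gtn_eqF // linear0.
Qed.

Lemma field_eq0 v U j xi m k :
  (\max_(i < N) size (v m j i) < k)%N -> field v k.*2 U j xi m = 0 :> V.
Proof.
move=> Mk; rewrite /field big1 // => i _; rewrite derivn_poly0 ?horner0 ?scale0r //.
have : (size (v m j i) <= \max_(i < N) size (v m j i))%N by apply: (leq_bigmax i).
by move: Mk; lia.
Qed.

(** In the convolution at order m + 1, the order-0 field contributes [G m.+1 U j], because it is
    constant in each element, and [G 0] contributes K_0 of the new field, which cancels the K_0 term
    on the right. *)
Lemma pde_step v G U j xi m B : holistic K H theta amp v G ->
  `|xi| < H / 2 -> (\max_(i < N) size (v m.+1 j i) <= B)%N ->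
  G m.+1 U j + \sum_(r < m) field v 0 (G (m - r)%N U) j xi r.+1 =
  \sum_(1 <= k < B.+1) K k (field v k.*2 U j xi m.+1).
Proof.
move=> hvG xr MB; have := holistic_pde hvG U j m.+1 xr.
rewrite -(@sum_nat_trunc _ (fun k => K k (field v k.*2 U j xi m.+1)) _ B.+1) //; last first.
  by move=> k Mk; rewrite field_eq0 ?linear0.
rewrite /field_dt big_ord_recl big_ord_recr /= subn0 (field_base _ _ _ _ hvG) /=.
rewrite subnn.
have -> : field v 0 (G 0%N U) j xi m.+1 = K 0%N (field v 0 U j xi m.+1).
  rewrite /field linear_sum; apply: eq_bigr => i _.
  by rewrite linearZ /= (holistic_G0 _ _ hvG).
by rewrite addrA addrC => /addrI.
Qed.

(** Apart from the jump itself every term carries a factor gamma, so the jump at order m + 1 is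
    determined by the fields at order m. *)
Lemma edge_u_jump v G U j m (uL := fun i => field v 0 U i (- (H / 2)))
    (uR := fun i => field v 0 U i (H / 2)) : holistic K H theta amp v G ->
  uR j m.+1 - uL j m.+1 = 2^-1 *: (uR j m - uL j m)
    + (2^-1 *: (uL (ordS j) m - uR (ord_pred j) m)
       + (2^-1 * theta) *: (uL j m + uR j m)
       - (2^-1 * theta) *: (uL (ordS j) m + uR (ord_pred j) m)).
Proof.
move=> hv; apply: (addIr (- (2^-1 *: (uR j m - uL j m)))).
by rewrite [RHS]addrC addrA addNr add0r; exact: (holistic_edge_u hv U j m.+1).
Qed.

Lemma edge_f_jump v G U j m (uL := fun i => field v 1 U i (- (H / 2)))
    (uR := fun i => field v 1 U i (H / 2)) : holistic K H theta amp v G ->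
  - uR j m.+1 - - uL j m.+1 = 2^-1 *: (- uR j m - - uL j m)
    + (2^-1 *: (- uL (ordS j) m - - uR (ord_pred j) m)
       - (2^-1 * theta) *: (- uL j m + - uR j m)
       + (2^-1 * theta) *: (- uL (ordS j) m + - uR (ord_pred j) m)).
Proof.
move=> hv; apply: (addIr (- (2^-1 *: (- uR j m - - uL j m)))).
by rewrite [RHS]addrC addrA addNr add0r; exact: (holistic_edge_f hv U j m.+1).
Qed.

Lemma edge_u_step v w G G' U j m :
  holistic K H theta amp v G -> holistic K H theta amp w G' -> v m = w m ->
  field v 0 U j (H / 2) m.+1 - field v 0 U j (- (H / 2)) m.+1 =
  field w 0 U j (H / 2) m.+1 - field w 0 U j (- (H / 2)) m.+1.
Proof.
move=> hv hw vw; rewrite (edge_u_jump _ _ _ hv) (edge_u_jump _ _ _ hw).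
by rewrite !(eq_field _ _ _ _ vw).
Qed.

Lemma edge_f_step v w G G' U j m :
  holistic K H theta amp v G -> holistic K H theta amp w G' -> v m = w m ->
  field v 1 U j (H / 2) m.+1 - field v 1 U j (- (H / 2)) m.+1 =
  field w 1 U j (H / 2) m.+1 - field w 1 U j (- (H / 2)) m.+1.
Proof.
move=> hv hw vw; apply: oppr_inj; rewrite !opprD.
rewrite (edge_f_jump _ _ _ hv) (edge_f_jump _ _ _ hw).
by rewrite !(eq_field _ _ _ _ vw).
Qed.

Lemma single_field (P : 'I_N -> R) (i : 'I_N) (u : V) :
  \sum_(k < N) P k *: (if k == i then u else 0) = P i *: u.
Proof.
rewrite (bigD1 i) //= eqxx big1 ?addr0 // => k ki.
by rewrite (negbTE ki) scaler0.
Qed.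

Lemma holistic_v_step v w G G' m (u : V) : u != 0 ->
  holistic K H theta amp v G -> holistic K H theta amp w G' ->
  (forall r, (r <= m)%N -> v r = w r) ->
  (forall r U, (r <= m)%N -> G r U = G' r U) ->
  v m.+1 = w m.+1.
Proof.
move=> u0 hv hw IHv IHG; apply/matrixP => j i.
set d := v m.+1 j i - w m.+1 j i.
(* Grid values concentrated at [i] turn a field into the single matrix entry (j, i) times [u]. *)
pose U k : V := if k == i then u else 0.
pose B := (maxn (\max_(i < N) size (v m.+1 j i)) (\max_(i < N) size (w m.+1 j i))).
have pde x : `|x| < H / 2 ->
    \sum_(1 <= k < B.+1) (d^`(k.*2)).[x] *: K k u = G m.+1 U j - G' m.+1 U j.
  move=> xr.
  have ev := @pde_step v G U j x m B hv xr (leq_maxl _ _).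
  have ew := @pde_step w G' U j x m B hw xr (leq_maxr _ _).
  have S : \sum_(r < m) field v 0 (G (m - r)%N U) j x r.+1 =
           \sum_(r < m) field w 0 (G' (m - r)%N U) j x r.+1.
    apply: eq_bigr => r _; rewrite IHG ?leq_subr //; apply: eq_field.
    by apply: IHv; exact: ltn_ord.
  have : (G m.+1 U j + \sum_(r < m) field v 0 (G (m - r)%N U) j x r.+1)
     - (G' m.+1 U j + \sum_(r < m) field w 0 (G' (m - r)%N U) j x r.+1)
     = G m.+1 U j - G' m.+1 U j.
    by rewrite S opprD addrACA subrr addr0.
  move=> <-; rewrite ev ew -sumrB; apply: eq_bigr => k _.
  rewrite /field /U !single_field -linearB -scalerBl linearZ /=.
  by rewrite /d derivnB hornerD hornerN.
(* Were d'' of positive degree, its leading degree in the polynomial identity would receive a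
   contribution from k = 1 only: the higher derivatives have lower degree and the right-hand side is
   constant. This would give K_1 u = 0. *)
have d2 : (size (d^`(2)) <= 1)%N.
  rewrite leqNgt; apply/negP => s2.
  pose c e : V := \sum_(1 <= k < B.+1) (d^`(k.*2))`_e *: K k u
                  - (if e == 0%N then G m.+1 U j - G' m.+1 U j else 0).
  have c0 e : (e < (size d).+1)%N -> c e = 0.
    apply: (@vector_poly_eq0 (H / 2)); first by rewrite divr_gt0.
    move=> x xr; rewrite /c.
    under eq_bigr do rewrite scalerBr.
    rewrite sumrB [X in _ - X]big_ord_recl /= expr0 scale1r [X in _ - (_ + X)]big1.
      2: by move=> k _; rewrite scaler0.
    rewrite addr0 -(pde _ xr); apply/eqP; rewrite subr_eq0; apply/eqP.
    under eq_bigr do rewrite scaler_sumr.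
    rewrite exchange_big /=; apply: eq_bigr => k _.
    rewrite (horner_coef_wide _ (n := (size d).+1)); last first.
      by rewrite leqW // size_derivn_leq.
    by rewrite scaler_suml; apply: eq_bigr => l _; rewrite scalerA mulrC.
  have sd : (size d^`(2) <= size d)%N by exact: size_derivn_leq.
  have := c0 (size d^`(2)).-1; rewrite /c ifF; last by lia.
  have B1 : (0 < B)%N.
    have : (size d <= B)%N.
      rewrite (leq_trans (size_polyD _ _)) // size_polyN geq_max !leq_max.
      apply/andP; split.
        by rewrite (leq_bigmax i).
      by rewrite [X in _ || X](leq_bigmax i) orbT.
    by lia.
  rewrite subr0 big_nat_recl // big_nat_cond big1 ?addr0; last first.
    move=> k /andP[/andP[k0 _] _].
    have -> : d^`(k.+1.*2) = d^`(2)^`(k.*2).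
      by rewrite /derivn -iterD addnC; congr (iter _ _ _).
    rewrite coef_derivn nth_default ?mul0rn ?scale0r //.
    by move: s2 k0; clear; case: (size _) => [|s] /=; lia.
  have lt : ((size d^`(2)).-1 < (size d).+1)%N by lia.
  move=> /(_ lt) /eqP; rewrite scaler_eq0 => /orP[|].
    by rewrite lead_coef_eq0 -size_poly_eq0 => /eqP sz; rewrite sz in s2.
  by move=> /eqP Ku; case/eqP: u0; apply: K1_inj; rewrite Ku linear0.
have d3 e : (2 < e)%N -> d`_e = 0.
  move=> e3; have : (d^`(2))`_(e - 2) = 0 by rewrite nth_default // (leq_trans d2) // subn_gt0.
  rewrite coef_derivn addnC subnK; last by lia.
  move/eqP; rewrite mulrn_eq0 => /orP[|/eqP //].
  by rewrite -leqn0 leqNgt ffact_gt0 (ltnW e3).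
have dE x : d.[x] = d`_0 + d`_1 * x + d`_2 * x ^+ 2.
  rewrite (horner_coef_wide _ (n := 3)); last by apply/leq_sizeP => e; exact: d3.
  by rewrite !big_ord_recl big_ord0 /= addr0 mulr1 addrA.
have d'E x : d^`().[x] = d`_1 + 2 * d`_2 * x.
  rewrite (horner_coef_wide _ (n := 2)); last first.
    by apply/leq_sizeP => e e2; rewrite coef_deriv d3 ?mul0rn.
  by rewrite !big_ord_recl big_ord0 /= !coef_deriv addr0 mulr1 mulr2n; ring.
have fieldB k x : field v k U j x m.+1 - field w k U j x m.+1 = (d^`(k)).[x] *: u.
  by rewrite /field /U !single_field -scalerBl /d derivnB hornerD hornerN.
have jump k : field v k U j (H / 2) m.+1 - field v k U j (- (H / 2)) m.+1 =
     field w k U j (H / 2) m.+1 - field w k U j (- (H / 2)) m.+1 ->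
     (d^`(k)).[H / 2] = (d^`(k)).[- (H / 2)].
  move=> e; apply/eqP; rewrite -subr_eq0 -(orbF (_ == 0)) -(negbTE u0) -scaler_eq0.
  rewrite scalerBl -!fieldB opprD opprK addrACA e.
  by rewrite [- _ + _]addrC -[X in _ + X]opprB subrr.
have h0 : H / 2 != 0 by rewrite mulf_neq0 ?gt_eqF // invr_neq0.
(* As d is at most quadratic, the vanishing jump of d' kills its quadratic coefficient, and then
   that of d the linear one. *)
have := jump 1%N (edge_f_step _ _ hv hw (IHv m (leqnn m))).
rewrite derivn1 !d'E => /addrI /eqP; rewrite mulrN -subr_eq0 opprK -mulr2n mulrn_eq0 /=.
rewrite mulf_eq0 (negbTE h0) orbF mulf_eq0 pnatr_eq0 /= => /eqP d20.
have := jump 0%N (edge_u_step _ _ hv hw (IHv m (leqnn m))).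
rewrite derivn0 !dE d20 !mul0r !addr0 => /addrI /eqP.
rewrite mulrN -subr_eq0 opprK -mulr2n mulrn_eq0 /= mulf_eq0 (negbTE h0) orbF => /eqP d10.
have dC : d = (d`_0)%:P.
  apply/polyP => -[|[|[|e]]]; rewrite coefC //= d3 //.
have : amplitude_of amp H d = 0.
  by rewrite amplitudeB (holistic_amplitude hv) (holistic_amplitude hw) subrr.
rewrite dC amplitudeC => d00.
by apply/eqP; rewrite -subr_eq0 -/d dC d00.
Qed.

Lemma holistic_unique v w G G' (u : V) : u != 0 ->
  holistic K H theta amp v G -> holistic K H theta amp w G' ->
  forall m, v m = w m /\ (forall U j, G m U j = G' m U j).
Proof.
move=> u0 hv hw m; elim/ltn_ind: m => -[|m] IH.
  split; last by move=> U j; rewrite (holistic_G0 _ _ hv) (holistic_G0 _ _ hw).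
  by apply/matrixP => j i; rewrite (holistic_base hv) (holistic_base hw).
have vw : v m.+1 = w m.+1.
  apply: (holistic_v_step u0 hv hw) => [r rm|r U rm]; first by have [] := IH r rm.
  by apply/funext => j; have [_] := IH r rm.
split => // U j.
(* Once the fields agree, the evolution equation at the midpoint alone determines [G m.+1]. *)
have h0 : `|0 : R| < H / 2 by rewrite normr0 divr_gt0.
have ev := @pde_step v G U j 0 m _ hv h0 (leqnn _).
have ew := @pde_step w G' U j 0 m _ hw h0 (leqnn _).
move: ev ew; rewrite vw => ev ew.
have : G m.+1 U j + \sum_(r < m) field v 0 (G (m - r)%N U) j 0 r.+1 =
       G' m.+1 U j + \sum_(r < m) field w 0 (G' (m - r)%N U) j 0 r.+1.
  rewrite ev ew; apply: eq_bigr => k _; congr (K k _); exact: eq_field.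
suff -> : \sum_(r < m) field v 0 (G (m - r)%N U) j 0 r.+1 =
  \sum_(r < m) field w 0 (G' (m - r)%N U) j 0 r.+1 by move/addIr.
apply: eq_bigr => r _; have [_ E] := IH (m - r)%N (leq_subr _ _ : (_ < m.+1)%N).
have -> : G (m - r)%N U = G' (m - r)%N U by apply/funext => i; exact: E.
by apply: eq_field; have [] := IH r.+1 (ltn_ord r).
Qed.

End Uniqueness.

Theorem mainTheorem16 (R : realType) (V : completeNormedModType R)
    (dot : {dot V for idfun}) (hdot : forall u : V, dot u u = `|u| ^+ 2)
    (K : nat -> {linear V -> V}) (hK1 : bijective (K 1%N))
    (H theta : R) (hH : 0 < H) :
  exists S : nat -> stencil V,
  [/\ expands_formula K H theta S,
      forall (N : nat) (amp : amplitude), (0 < N)%N ->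
        (exists v G, @holistic R V N K H theta amp v G) /\
        (forall v G, @holistic R V N K H theta amp v G ->
           forall m U j, G m U j = apply_stencil (S m) U j)
    & forall p : nat, (0 < p)%N ->
        (forall g : R, has_stencil_width (2 * p).-1 (truncation p g S)) /\
        consistent_to K H p (truncation p 1 S)].
Proof.
have H0 : H != 0 by rewrite gt_eqF.
exists (holistic_stencil K H theta); split.
- exact: holistic_stencil_expands.
- move=> [|n] // amp _.
  have w := @holistic_exists R n V K H theta amp H0.
  split; first by exists (subgrid n H theta amp), (G_op K H theta).
  move=> v G hv m U j.
  (* A nonzero vector is what recovers the real matrix entries from the fields; in the zero space
     the equality is trivial. *)
  have [[u u0]|V0] := pselect (exists u : V, u != 0).
    by have [_ ->] := holistic_unique hH (bij_inj hK1) u0 hv w m.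
  have V1 (x : V) : x = 0.
    by apply/eqP/negPn/negP => x0; apply: V0; exists x.
  by rewrite [LHS]V1 [RHS]V1.
- move=> p p0; split; first by move=> g; exact: holistic_stencil_width.
  exact: holistic_stencil_consistent.
Qed.
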